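(* Let $n\geqslant 3$ and let $\varLambda_n:D(\varLambda_n)\subset Y\to Y$ be the unbounded linear operator with $$D(\varLambda_n)=X^1\times X^{\frac{n-1}{n}}\times X^{\frac{n-2}{n}}\times\cdots\times X^{\frac1n},\qquad \varLambda_n\,(v_1,v_2,\ldots,v_{n-1},v_n)^{T}=(-v_2,-v_3,\ldots,-v_n,\,Av_1)^{T}.$$ Then $-\varLambda_n$ is not the infinitesimal generator of a strongly continuous semigroup on $Y$.
   Context: $X$ is a separable complex Hilbert space and $A:D(A)\subset X\to X$ is an unbounded, closed, densely defined, self-adjoint and positive definite linear operator; there is $\lambda_0>0$ with $\mathrm{Re}\,\lambda>\lambda_0$ for all $\lambda\in\sigma(A)$. For $0<\alpha<1$, $A^\alpha$ is the fractional power of $A$ (the usual closed operator, given by Balakrishnan's formula $A^\alpha=\frac{\sin(\alpha\pi)}{\pi}\int_0^\infty\lambda^{\alpha-1}A(\lambda I+A)^{-1}\,d\lambda$, equivalently by the spectral theorem), with $A^0=I$, $A^1=A$. For $0\leqslant\alpha\leqslant1$, $X^\alpha:=D(A^\alpha)$ with norm $\|x\|_{X^\alpha}=\|A^\alpha x\|_X$, and $X^0=X$. The phase space is $Y=X^{\frac{n-1}{n}}\times X^{\frac{n-2}{n}}\times\cdots\times X^{\frac1n}\times X$ (the $i$-th factor is $X^{\frac{n-i}{n}}$, $1\leqslant i\leqslant n$), with norm given by $\|(v_1,\ldots,v_n)\|_Y^2=\sum_{i=1}^n\|v_i\|^2_{X^{\frac{n-i}{n}}}$. *)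

(* Defs.v *)
From Stdlib Require Import Reals FunctionalExtensionality.
From Coquelicot Require Import Coquelicot.
From mathcomp Require Import ssreflect ssrfun ssrbool eqtype ssrnat fintype bigop.

Set Implicit Arguments.
Unset Strict Implicit.
Unset Printing Implicit Defensive.

Open Scope R_scope.

Definition fct_AbelianMonoid_mixin (I : Type) (V : AbelianGroup) :
  AbelianMonoid.mixin_of (I -> V).
Proof.
apply (@AbelianMonoid.Mixin _ (fun u v i => plus (u i) (v i)) (fun _ => zero));
  intros; apply functional_extensionality => i.
- exact: plus_comm.
- exact: plus_assoc.
- exact: plus_zero_r.
Defined.

Canonical fct_AbelianMonoid (I : Type) (V : AbelianGroup) : AbelianMonoid :=
  AbelianMonoid.Pack (I -> V) (fct_AbelianMonoid_mixin I V) (I -> V).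

Definition fct_AbelianGroup_mixin (I : Type) (V : AbelianGroup) :
  AbelianGroup.mixin_of (fct_AbelianMonoid I V).
Proof.
apply (@AbelianGroup.Mixin (fct_AbelianMonoid I V) (fun u i => opp (u i))).
move=> u; apply functional_extensionality => i; exact: plus_opp_r.
Defined.

Canonical fct_AbelianGroup (I : Type) (V : AbelianGroup) : AbelianGroup :=
  AbelianGroup.Pack (I -> V)
    (AbelianGroup.Class _ (fct_AbelianMonoid_mixin I V)
       (fct_AbelianGroup_mixin I V)) (I -> V).

Definition fct_ModuleSpace_mixin (I : Type) (K : Ring) (V : ModuleSpace K) :
  ModuleSpace.mixin_of K (fct_AbelianGroup I V).
Proof.
apply (@ModuleSpace.Mixin K (fct_AbelianGroup I V)
         (fun a (u : I -> V) i => scal a (u i)));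
  intros; apply functional_extensionality => i.
- exact: scal_assoc.
- exact: scal_one.
- exact: scal_distr_l.
- exact: scal_distr_r.
Defined.

Canonical fct_ModuleSpace (I : Type) (K : Ring) (V : ModuleSpace K) :
  ModuleSpace K :=
  ModuleSpace.Pack K (I -> V)
    (ModuleSpace.Class K (I -> V)
       (AbelianGroup.Class _ (fct_AbelianMonoid_mixin I V)
          (fct_AbelianGroup_mixin I V))
       (fct_ModuleSpace_mixin I V)) (I -> V).

(** Coquelicot integrates functions [R -> V] only when [V] is normed over [R].
    The structure below is not canonical, so that [scal] on a complex space
    always means multiplication by a complex number. *)

Section RealRestriction.

Variable X : CompleteNormedModule C_AbsRing.

Definition real_ModuleSpace_mixin :
  ModuleSpace.mixin_of R_Ring (NormedModule.AbelianGroup _ X).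
Proof.
apply (@ModuleSpace.Mixin R_Ring (NormedModule.AbelianGroup _ X)
         (fun (a : R) (x : X) => scal (RtoC a) x)).
- move=> a b x; rewrite scal_assoc /mult /= RtoC_mult; reflexivity.
- move=> x; exact: scal_one.
- move=> a x y; exact: scal_distr_l.
- move=> a b x; rewrite /plus /= RtoC_plus; exact: scal_distr_r.
Defined.

Definition real_NormedModuleAux : NormedModuleAux R_AbsRing :=
  NormedModuleAux.Pack R_AbsRing X
    (NormedModuleAux.Class R_AbsRing X
       (ModuleSpace.Class R_Ring X
          (AbelianGroup.class (NormedModule.AbelianGroup _ X))
          real_ModuleSpace_mixin)
       (UniformSpace.class (NormedModule.UniformSpace _ X))) X.

Definition real_NormedModule_mixin :
  NormedModule.mixin_of R_AbsRing real_NormedModuleAux.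
Proof.
apply (@NormedModule.Mixin R_AbsRing real_NormedModuleAux
         (fun x : X => norm x) (@norm_factor _ X)).
- move=> x y; exact: norm_triangle.
- move=> a x; rewrite /abs /= -Cmod_R.
  exact: (@norm_scal C_AbsRing X (RtoC a) x).
- move=> x y eps; exact: (@norm_compat1 C_AbsRing X).
- move=> x y eps; exact: (@norm_compat2 C_AbsRing X).
- move=> x; exact: (@norm_eq_zero C_AbsRing X).
Defined.

Definition real_restriction : CompleteNormedModule R_AbsRing :=
  CompleteNormedModule.Pack R_AbsRing X
    (CompleteNormedModule.Class R_AbsRing X
       (NormedModule.Class R_AbsRing X
          (NormedModuleAux.class R_AbsRing real_NormedModuleAux)
          real_NormedModule_mixin)
       (CompleteSpace.mixin _
          (CompleteSpace.class (CompleteNormedModule.CompleteSpace _ X)))) X.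

End RealRestriction.

(** The inner product is linear in its first argument. Since [norm x] is a
    real number, [inner_self] contains both positivity and definiteness. *)
Record HilbertSpace := {
  hilbert_space :> CompleteNormedModule C_AbsRing;
  inner : hilbert_space -> hilbert_space -> C;
  inner_conj : forall x y, inner y x = Cconj (inner x y);
  inner_plus : forall x y z, inner (plus x y) z = Cplus (inner x z) (inner y z);
  inner_scal : forall (a : C) x y, inner (scal a x) y = Cmult a (inner x y);
  inner_self : forall x, inner x x = RtoC (norm x ^ 2)
}.

Arguments inner {h} _ _.

Definition separable (X : NormedModule C_AbsRing) : Prop :=
  exists u : nat -> X,
    forall (x : X) (eps : R), 0 < eps -> exists k, norm (minus (u k) x) < eps.

(** The values of [app] outside [dom] are never used. *)
Record operator (V : Type) := Operator { dom : V -> Prop; app : V -> V }.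

Definition graph (V : Type) (A : operator V) (x y : V) : Prop :=
  dom A x /\ app A x = y.

Definition opp_op (V : AbelianGroup) (A : operator V) : operator V :=
  Operator (dom A) (fun v => opp (app A v)).

Definition linear_operator (V : ModuleSpace C_Ring) (A : operator V) : Prop :=
  dom A zero /\
  (forall x y, dom A x -> dom A y ->
     dom A (plus x y) /\ app A (plus x y) = plus (app A x) (app A y)) /\
  (forall (a : C) x, dom A x ->
     dom A (scal a x) /\ app A (scal a x) = scal a (app A x)).

Section Operators.

Variable X : CompleteNormedModule C_AbsRing.
Implicit Type A : operator X.

Definition graph_closure (G : X -> X -> Prop) (x y : X) : Prop :=
  forall eps : R, 0 < eps ->
    exists x' y', G x' y' /\ norm (minus x' x) < eps /\ norm (minus y' y) < eps.

Definition closed_operator A : Prop :=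
  forall x y, graph_closure (graph A) x y -> graph A x y.

Definition densely_defined A : Prop :=
  forall (x : X) (eps : R), 0 < eps ->
    exists x', dom A x' /\ norm (minus x' x) < eps.

Definition bounded_operator A : Prop :=
  exists M : R, forall x, dom A x -> norm (app A x) <= M * norm x.

Definition resolvent_set A (l : C) : Prop :=
  exists B : X -> X,
    (forall x, dom A (B x) /\ minus (scal l (B x)) (app A (B x)) = x) /\
    (forall x, dom A x -> B (minus (scal l x) (app A x)) = x) /\
    (exists M : R, forall x, norm (B x) <= M * norm x).

Definition spectrum A (l : C) : Prop := ~ resolvent_set A l.

(** [(l I + A)^-1 x], for [- l] in the resolvent set of [A] *)
Definition shift_inv A (l : R) (x : X) : X :=
  iota (fun z : X => dom A z /\ plus (scal (RtoC l) z) (app A z) = x).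

(** Balakrishnan's formula defines [A^a] on [dom A], which is a core of [A^a];
    the operator [A^a] itself is the closure. *)
Definition balakrishnan A (a : R) (x y : X) : Prop :=
  dom A x /\
  exists z : X,
    is_RInt_gen (V := real_restriction X)
      (fun l : R => scal (RtoC (Rpower l (a - 1))) (app A (shift_inv A l x)))
      (at_right 0) (Rbar_locally p_infty) z /\
    y = scal (RtoC (sin (a * PI) / PI)) z.

Definition balakrishnan_closure A (a : R) : operator X :=
  Operator (fun x => exists y, graph_closure (balakrishnan A a) x y)
           (fun x => iota (graph_closure (balakrishnan A a) x)).

Definition frac_pow A (a : R) : operator X :=
  if Req_EM_T a 0 then Operator (fun _ => True) (fun x => x)
  else if Req_EM_T a 1 then A
  else balakrishnan_closure A a.

Definition frac_norm A (a : R) (x : X) : R := norm (app (frac_pow A a) x).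

End Operators.

Section Hilbert.

Variable X : HilbertSpace.
Implicit Type A : operator X.

(** The left-hand side says that [(y, z)] lies in the graph of the adjoint. *)
Definition self_adjoint A : Prop :=
  forall y z : X,
    (forall x, dom A x -> inner (app A x) y = inner x z) <-> graph A y z.

Definition positive_definite A : Prop :=
  forall x : X, dom A x -> x <> zero -> 0 < Re (inner (app A x) x).

End Hilbert.

(** A normed space realised as a subspace [carrier] of a vector space [V],
    with its own norm [nrm], which is only meaningful on [carrier]. *)
Record normed_subspace (V : ModuleSpace C_Ring) :=
  NormedSubspace { carrier : V -> Prop; nrm : V -> R }.

Section Semigroups.

Variables (V : ModuleSpace C_Ring) (Y : normed_subspace V).
Implicit Types (T : R -> V -> V) (G : operator V).

Record C0_semigroup T : Prop := {
  C0_stable : forall t v, 0 <= t -> carrier Y v -> carrier Y (T t v);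
  C0_plus : forall t u v, 0 <= t -> carrier Y u -> carrier Y v ->
    T t (plus u v) = plus (T t u) (T t v);
  C0_scal : forall t (a : C) v, 0 <= t -> carrier Y v ->
    T t (scal a v) = scal a (T t v);
  C0_bounded : forall t, 0 <= t ->
    exists M : R, forall v, carrier Y v -> nrm Y (T t v) <= M * nrm Y v;
  C0_zero : forall v, carrier Y v -> T 0 v = v;
  C0_add : forall s t v, 0 <= s -> 0 <= t -> carrier Y v ->
    T (s + t) v = T s (T t v);
  C0_continuous : forall v, carrier Y v ->
    filterlim (fun t => nrm Y (minus (T t v) v)) (at_right 0) (locally 0)
}.

Definition infinitesimal_generator T G : Prop :=
  forall v w : V,
    (carrier Y v /\ carrier Y w /\
     filterlim
       (fun h => nrm Y (minus (scal (RtoC (/ h)) (minus (T h v) v)) w))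
       (at_right 0) (locally 0))
    <-> graph G v w.

Definition generates_C0_semigroup G : Prop :=
  exists T, C0_semigroup T /\ infinitesimal_generator T G.

End Semigroups.

(** Indices start at [0]: [v i] stands for the component [v_{i+1}]. *)

Definition phase_space (X : CompleteNormedModule C_AbsRing) (A : operator X)
    (n : nat) : normed_subspace (fct_ModuleSpace 'I_n X) :=
  NormedSubspace (V := fct_ModuleSpace 'I_n X)
    (fun v : 'I_n -> X =>
       forall i : 'I_n, dom (frac_pow A (INR (n - i.+1)%N / INR n)) (v i))
    (fun v : 'I_n -> X =>
       sqrt (\big[Rplus/0]_(i < n)
               (frac_norm A (INR (n - i.+1)%N / INR n) (v i)) ^ 2)).

(** [ordS] is the cyclic successor of ['I_n]: it sends the last index to [0]. *)
Definition Lambda (X : CompleteNormedModule C_AbsRing) (A : operator X)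
    (n : nat) : operator ('I_n -> X) :=
  Operator
    (fun v : 'I_n -> X =>
       forall i : 'I_n, dom (frac_pow A (INR (n - i)%N / INR n)) (v i))
    (fun (v : 'I_n -> X) (i : 'I_n) =>
       if (i.+1 < n)%N then opp (v (ordS i)) else app A (v (ordS i))).

(* Main.v *)
Require Import Defs.
From Stdlib Require Import Reals Lra Lia.
From Stdlib Require Import FunctionalExtensionality Classical ClassicalEpsilon.
From Coquelicot Require Import Coquelicot.
From mathcomp Require Import ssreflect ssrfun ssrbool eqtype ssrnat div seq.
From mathcomp Require Import fintype bigop.

(** Formally [-Lambda_n] has the eigenvectors (x, l x, ..., l^(n-1) x) with
    A x = mu x and l^n = -mu, and for n >= 3 the root l = mu^(1/n) e^(i pi/n)
    lies in the open right half-plane, with Re l unbounded as mu grows.  Since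
    A is unbounded, self-adjoint and positive, it has approximate eigenvectors
    for arbitrarily large mu; they give approximate eigenvectors of [-Lambda_n].
    For the generator G of a C0 semigroup on the complete space Y, on the other
    hand, |v| <= K |G v - l v| as soon as Re l is large, a contradiction. *)

(** The residual of the approximate eigenvector v with components l^i x vanishes in every component
    but the last. The last factor of Y has exponent 0, so there the norm is the plain norm of X, and
    the same component already gives |v| >= |x| once |l| >= 1. The fractional norms of x are thus
    never estimated. Fractional powers enter through two facts: their domains contain that of A, so
    that v lies in the domain of Lambda_n, and they are linear, closed and bounded below, so that Y
    is complete. Completeness turns the boundedness of each single operator T t into a bound uniform
    for small t, by the uniform boundedness principle. A itself may have no eigenvalue at all; the
    large part of its spectrum is sought near 0 for the bounded inverse of A, where maximizing a
    quadratic form does the work of the spectral theorem. A constant K independent of l suffices,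
    because the accuracy of the approximate eigenvector of A is chosen after K. *)

Set Implicit Arguments.
Unset Strict Implicit.
Unset Printing Implicit Defensive.

Open Scope R_scope.

(** Reflexive decision of linear identities in a complex module: both sides are
    evaluated at their atoms and compared coefficientwise. *)
Inductive mexpr :=
  | MVar of nat | MZero | MPlus of mexpr & mexpr | MOpp of mexpr
  | MScal of C & mexpr.

Fixpoint meval (V : ModuleSpace C_Ring) (l : list V) (e : mexpr) : V :=
  match e with
  | MVar i => List.nth i l zero
  | MZero => zero
  | MPlus e1 e2 => plus (meval l e1) (meval l e2)
  | MOpp e1 => opp (meval l e1)
  | MScal c e1 => scal c (meval l e1)
  end.

Fixpoint mcoef (e : mexpr) (k : nat) : C :=
  match e with
  | MVar i => if Nat.eqb i k then RtoC 1 else RtoC 0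
  | MZero => RtoC 0
  | MPlus e1 e2 => Cplus (mcoef e1 k) (mcoef e2 k)
  | MOpp e1 => Copp (mcoef e1 k)
  | MScal c e1 => Cmult c (mcoef e1 k)
  end.

Fixpoint mcomb (V : ModuleSpace C_Ring) (l : list V) (f : nat -> C) : V :=
  match l with
  | nil => zero
  | cons x l' => plus (scal (f O) x) (mcomb l' (fun k => f (S k)))
  end.

(** Only as many coefficients are compared as there are atoms, so the relation unfolds to a finite
    conjunction of equations in [C], which [cring] settles by real and imaginary parts. *)
Fixpoint mcoef_eq (V : Type) (l : list V) (f g : nat -> C) : Prop :=
  match l with
  | nil => True
  | cons _ l' => f O = g O /\ mcoef_eq l' (fun k => f (S k)) (fun k => g (S k))
  end.

Lemma mcomb_ext (V : ModuleSpace C_Ring) (l : list V) (f g : nat -> C) :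
  mcoef_eq l f g -> mcomb l f = mcomb l g.
Proof. by elim: l f g => [//|x l IH] f g /= [-> /IH ->]. Qed.

Lemma mcomb_zero (V : ModuleSpace C_Ring) (l : list V) :
  mcomb l (fun _ => RtoC 0) = zero.
Proof.
elim: l => [//|x l /= ->].
by rewrite plus_zero_r; exact: scal_zero_l.
Qed.

Lemma mcomb_plus (V : ModuleSpace C_Ring) (l : list V) (f g : nat -> C) :
  mcomb l (fun k => Cplus (f k) (g k)) = plus (mcomb l f) (mcomb l g).
Proof.
elim: l f g => [|x l IH] f g /=; first by rewrite plus_zero_r.
rewrite IH (scal_distr_r (K := C_Ring) (f O) (g O) x).
rewrite -!plus_assoc; congr (plus _ _); rewrite !plus_assoc.
by congr (plus _ _); exact: plus_comm.
Qed.

Lemma mcomb_scal (V : ModuleSpace C_Ring) (l : list V) (a : C) (f : nat -> C) :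
  mcomb l (fun k => Cmult a (f k)) = scal a (mcomb l f).
Proof.
elim: l f => [|x l IH] f /=.
  by symmetry; exact: (scal_zero_r (K := C_Ring)).
rewrite IH (scal_distr_l (K := C_Ring)); congr (plus _ _).
by symmetry; exact: (scal_assoc (K := C_Ring)).
Qed.

Lemma mcomb_nth (V : ModuleSpace C_Ring) (l : list V) (i : nat) :
  mcomb l (fun k => if Nat.eqb i k then RtoC 1 else RtoC 0) = List.nth i l zero.
Proof.
elim: l i => [|x l IH] [|i] //=.
- rewrite mcomb_zero plus_zero_r; exact: (scal_one (K := C_Ring)).
- by rewrite IH (scal_zero_l (K := C_Ring) x : scal (RtoC 0) x = zero) plus_zero_l.
Qed.

Lemma mevalE (V : ModuleSpace C_Ring) (l : list V) (e : mexpr) :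
  meval l e = mcomb l (mcoef e).
Proof.
elim: e => [i||e1 IH1 e2 IH2|e IH|c e IH] /=.
- by rewrite mcomb_nth.
- by rewrite mcomb_zero.
- by rewrite mcomb_plus IH1 IH2.
- rewrite IH -(scal_opp_one (K := C_Ring)) -mcomb_scal.
  congr (mcomb l _); apply: functional_extensionality => k.
  by rewrite /opp /one /=; ring.
- by rewrite mcomb_scal IH.
Qed.

Lemma meval_eq (V : ModuleSpace C_Ring) (l : list V) (e1 e2 : mexpr) :
  mcoef_eq l (mcoef e1) (mcoef e2) -> meval l e1 = meval l e2.
Proof. by rewrite !mevalE => /mcomb_ext. Qed.

Ltac mod_find x l :=
  match l with
  | cons ?y _ => let _ := match goal with _ => unify x y end in constr:(O)
  | cons _ ?l' => let n := mod_find x l' in constr:(S n)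
  end.

Ltac mod_atoms t l :=
  match t with
  | @zero _ => l
  | @plus _ ?a ?b => let l1 := mod_atoms a l in mod_atoms b l1
  | @opp _ ?a => mod_atoms a l
  | @scal _ _ _ ?a => mod_atoms a l
  | ?x => match l with
          | _ => let n := mod_find x l in l
          | _ => constr:(cons x l)
          end
  end.

Ltac mod_reify t l :=
  match t with
  | @zero _ => constr:(MZero)
  | @plus _ ?a ?b =>
      let ea := mod_reify a l in let eb := mod_reify b l in constr:(MPlus ea eb)
  | @opp _ ?a => let ea := mod_reify a l in constr:(MOpp ea)
  | @scal _ _ ?c ?a => let ea := mod_reify a l in constr:(MScal c ea)
  | ?x => let n := mod_find x l in constr:(MVar n)
  end.

Ltac cring :=
  cbn [mcoef mcoef_eq Nat.eqb Cpow];
  try (apply: injective_projections;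
       cbv [Cplus Cmult Copp Cminus RtoC mult plus opp one zero
            Ring.mult AbelianMonoid.plus AbelianGroup.opp AbelianMonoid.zero Ring.one];
       cbn [fst snd]; ring).

Ltac module V :=
  rewrite /minus;
  match goal with
  | |- ?a = ?b =>
      let l0 := mod_atoms a (@nil V) in
      let l := mod_atoms b l0 in
      let ea := mod_reify a l in
      let eb := mod_reify b l in
      change (@meval V l ea = @meval V l eb);
      apply: meval_eq; cbn [mcoef_eq]; repeat (split; [cring|]); try exact: I
  end.

(** * Semigroups on complete seminormed spaces *)

Record is_seminorm (V : ModuleSpace C_Ring) (Y : normed_subspace V) : Prop := {
  seminorm_carrier_zero : carrier Y zero;
  seminorm_carrier_plus : forall u v,
    carrier Y u -> carrier Y v -> carrier Y (plus u v);
  seminorm_carrier_scal : forall (a : C) v, carrier Y v -> carrier Y (scal a v);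
  seminorm_triangle : forall u v, carrier Y u -> carrier Y v ->
    nrm Y (plus u v) <= nrm Y u + nrm Y v;
  seminorm_scal : forall (a : C) v, carrier Y v ->
    nrm Y (scal a v) = Cmod a * nrm Y v
}.

Definition is_complete (V : ModuleSpace C_Ring) (Y : normed_subspace V) : Prop :=
  forall u : nat -> V,
    (forall k, carrier Y (u k)) ->
    (forall eps, 0 < eps -> exists N : nat, forall k m : nat,
       (N <= k)%coq_nat -> (N <= m)%coq_nat -> nrm Y (minus (u k) (u m)) < eps) ->
    exists x, carrier Y x /\
      forall eps, 0 < eps -> exists N : nat, forall k : nat,
        (N <= k)%coq_nat -> nrm Y (minus (u k) x) < eps.

Definition linear_on (V : ModuleSpace C_Ring) (P : V -> Prop) (L : V -> V) : Prop :=
  (forall v, P v -> P (L v)) /\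
  (forall u v, P u -> P v -> L (plus u v) = plus (L u) (L v)) /\
  (forall (a : C) v, P v -> L (scal a v) = scal a (L v)).

(** * The uniform boundedness principle *)

Section Seminorm.

Variables (V : ModuleSpace C_Ring) (Y : normed_subspace V).
Hypothesis HY : is_seminorm Y.

Lemma carrier_minus u v : carrier Y u -> carrier Y v -> carrier Y (minus u v).
Proof.
move=> Hu Hv; have -> : minus u v = plus u (scal (RtoC (-1)) v) by module V.
apply: seminorm_carrier_plus => //; exact: seminorm_carrier_scal.
Qed.

Lemma seminorm_minus u v : carrier Y u -> carrier Y v ->
  nrm Y (minus u v) <= nrm Y u + nrm Y v.
Proof.
move=> Hu Hv; have -> : minus u v = plus u (scal (RtoC (-1)) v) by module V.
apply: Rle_trans.
  apply: (seminorm_triangle HY) => //; exact: seminorm_carrier_scal.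
by rewrite (seminorm_scal HY) // Cmod_R Rabs_left; lra.
Qed.

Lemma seminorm_zero : nrm Y zero = 0.
Proof.
have H0 := seminorm_carrier_zero HY.
have -> : (zero : V) = scal (RtoC 0) zero by module V.
by rewrite (seminorm_scal HY) // Cmod_R Rabs_R0; lra.
Qed.

Lemma seminorm_pos v : carrier Y v -> 0 <= nrm Y v.
Proof.
move=> Hv; have := seminorm_minus Hv Hv.
have -> : minus v v = zero by module V.
by rewrite seminorm_zero; lra.
Qed.

Lemma seminorm_sym u v : carrier Y u -> carrier Y v ->
  nrm Y (minus u v) = nrm Y (minus v u).
Proof.
move=> Hu Hv; have -> : minus u v = scal (RtoC (-1)) (minus v u) by module V.
by rewrite (seminorm_scal HY) ?Cmod_R ?Rabs_left; [lra|lra|exact: carrier_minus].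
Qed.

Lemma seminorm_le_plus_minus u v : carrier Y u -> carrier Y v ->
  nrm Y u <= nrm Y (minus u v) + nrm Y v.
Proof.
move=> Hu Hv; have {1}-> : u = plus (minus u v) v by module V.
apply: (seminorm_triangle HY) => //; exact: carrier_minus.
Qed.

Lemma linear_on_minus L u v : linear_on (carrier Y) L ->
  carrier Y u -> carrier Y v -> L (minus u v) = minus (L u) (L v).
Proof.
move=> [HL [Hp Hs]] Hu Hv.
have -> : minus u v = plus u (scal (RtoC (-1)) v) by module V.
rewrite Hp // ?Hs //; last exact: seminorm_carrier_scal.
by module V.
Qed.

(** [N] is the supremum over the unit ball. The gliding hump needs the second clause: a vector of
    the unit ball that nearly attains it. *)
Lemma operator_norm_exists L : linear_on (carrier Y) L ->
  (exists M, forall v, carrier Y v -> nrm Y (L v) <= M * nrm Y v) ->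
  exists N, (forall v, carrier Y v -> nrm Y (L v) <= N * nrm Y v) /\
    forall c, c < N -> exists v, carrier Y v /\ nrm Y v <= 1 /\ c < nrm Y (L v).
Proof.
move=> [HL [Hp Hs]] [M HM].
pose S c := exists v, carrier Y v /\ nrm Y v <= 1 /\ c = nrm Y (L v).
have [N [HN1 HN2]] : {N | is_lub S N}.
  apply: completeness.
  - exists (Rabs M) => c [v [Hv [Hv1 ->]]].
    have := HM v Hv; have := seminorm_pos Hv; have := Rle_abs M; have := Rabs_pos M.
    by nra.
  - exists (nrm Y (L zero)), zero; split; first exact: (seminorm_carrier_zero HY).
    by rewrite seminorm_zero; split; [lra|].
exists N; split.
- move=> v Hv; have Hv0 := seminorm_pos Hv.
  (* A vector of seminorm 0 cannot be rescaled to norm 1; the a priori bound [M] covers it. *)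
  case: (Req_dec (nrm Y v) 0) => Hv1; first by have := HM v Hv; rewrite Hv1; lra.
  have Hi : 0 < / nrm Y v by apply: Rinv_0_lt_compat; lra.
  have /HN1 : S (nrm Y (L (scal (RtoC (/ nrm Y v)) v))).
    exists (scal (RtoC (/ nrm Y v)) v); split; first exact: seminorm_carrier_scal.
    split=> //; rewrite (seminorm_scal HY) // Cmod_R Rabs_pos_eq; last lra.
    by rewrite Rinv_l //; lra.
  rewrite Hs // (seminorm_scal HY); last exact: HL.
  rewrite Cmod_R Rabs_pos_eq; last lra.
  move=> H; have -> : nrm Y (L v) = / nrm Y v * nrm Y (L v) * nrm Y v by field.
  by apply: Rmult_le_compat_r.
- move=> c Hc; apply: NNPP => Hn.
  have : N <= c; last lra.
  apply: HN2 => d [v [Hv [Hv1 ->]]].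
  apply: Rnot_lt_le => Hlt; apply: Hn; by exists v.
Qed.

Hypothesis HYc : is_complete Y.

(* A gliding hump: the k-th term of the Cauchy sequence is moved by at most
   3^-k so that the k-th operator is nearly as large there as its norm allows;
   the tail of the sequence, of size 3^-k / 2, cannot undo this. *)
Lemma uniform_boundedness (L : nat -> V -> V) :
  (forall k, linear_on (carrier Y) (L k)) ->
  (forall k, exists M, forall v, carrier Y v -> nrm Y (L k v) <= M * nrm Y v) ->
  (forall v, carrier Y v -> exists M, forall k, nrm Y (L k v) <= M) ->
  exists M, forall k v, carrier Y v -> nrm Y (L k v) <= M * nrm Y v.
Proof.
move=> HL Hb Hpt; apply: NNPP => Hn.
have [r [Hr [HrS Hr0]]] : exists r : nat -> R, (forall j, 0 < r j) /\
    (forall j, r (S j) = r j / 3) /\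
    forall eps, 0 < eps -> exists N, r N < eps.
  exists (fun j => (/ 3) ^ j); split; [|split].
  - by move=> j; apply: pow_lt; lra.
  - by move=> j /=; lra.
  - move=> eps Heps.
    have [N HN] := pow_lt_1_zero (/ 3) ltac:(rewrite Rabs_pos_eq; lra) eps Heps.
    exists N; have := HN N (le_n _); rewrite Rabs_pos_eq //.
    by apply: pow_le; lra.
(* In the end the hump contributes [5/6 * N * r j] and the tail costs at most [N * r j / 2]. The
   remaining [N * r j / 3] exceeds [INR j] because of this threshold for [N]. *)
have Hk j : exists k N, 3 * INR j / r j < N /\
    (forall v, carrier Y v -> nrm Y (L k v) <= N * nrm Y v) /\
    forall c, c < N -> exists v, carrier Y v /\ nrm Y v <= 1 /\ c < nrm Y (L k v).
  apply: NNPP => Hj; apply: Hn; exists (3 * INR j / r j) => k v Hv.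
  have [N [HN1 HN2]] := operator_norm_exists (HL k) (Hb k).
  case: (Rlt_dec (3 * INR j / r j) N) => HN; first by case: Hj; exists k, N.
  by have := HN1 v Hv; have := seminorm_pos Hv; nra.
have Hstep j (x : {x | carrier Y x}) : exists y : {x | carrier Y x}, exists k N,
    nrm Y (minus (proj1_sig y) (proj1_sig x)) <= r j /\
    3 * INR j / r j < N /\
    (forall v, carrier Y v -> nrm Y (L k v) <= N * nrm Y v) /\
    5 / 6 * N * r j <= nrm Y (L k (proj1_sig y)).
  case: x => x Hx /=.
  have [k [N [HN [HN1 HN2]]]] := Hk j.
  have HN0 : 0 < N.
    apply: Rle_lt_trans HN; apply: Rmult_le_pos; first by have := pos_INR j; lra.
    by apply: Rlt_le; apply: Rinv_0_lt_compat.
  have [v [Hv [Hv1 Hv2]]] := HN2 (5 / 6 * N) ltac:(lra).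
  pose d := scal (RtoC (r j)) v : V.
  have Hd : carrier Y d by exact: seminorm_carrier_scal.
  have Hdn : nrm Y d <= r j.
    rewrite (seminorm_scal HY) // Cmod_R Rabs_pos_eq; last by have := Hr j; lra.
    by have := Hr j; nra.
  have HLd : 5 / 6 * N * r j <= nrm Y (L k d).
    case: (HL k) => HLc [_ HLs]; rewrite /d HLs // (seminorm_scal HY); last exact: HLc.
    rewrite Cmod_R Rabs_pos_eq; last by have := Hr j; lra.
    by have := Hr j; nra.
  have Hxp : carrier Y (plus x d) by exact: seminorm_carrier_plus.
  have Hxm : carrier Y (minus x d) by exact: carrier_minus.
  (* The two images differ by [2 * L k d], so they cannot both be shorter than the lower bound known
     for [L k d]. *)
  have Hor : 5 / 6 * N * r j <= nrm Y (L k (plus x d)) \/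
             5 / 6 * N * r j <= nrm Y (L k (minus x d)).
    case: (Rle_dec (5 / 6 * N * r j) (nrm Y (L k (plus x d)))) => H1; first by left.
    right; have HLc := (proj1 (HL k)).
    have := seminorm_minus (HLc _ Hxp) (HLc _ Hxm).
    rewrite -linear_on_minus //.
    have -> : minus (plus x d) (minus x d) = scal (RtoC 2) d by module V.
    rewrite (proj2 (proj2 (HL k))) // (seminorm_scal HY); last exact: HLc.
    by rewrite Cmod_R Rabs_pos_eq; lra.
  case: Hor => Hor.
  - exists (exist _ _ Hxp), k, N; split=> //=.
    by have -> : minus (plus x d) x = d by module V.
  - exists (exist _ _ Hxm), k, N; split=> //=.
    rewrite seminorm_sym //.
    by have -> : minus x (minus x d) = d by module V.
pose next j x := proj1_sig (constructive_indefinite_description _ (Hstep j x)).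
pose u := fix u j := match j with
  | O => exist _ _ (seminorm_carrier_zero HY)
  | S j' => next j' (u j') end.
have Hu j : exists k N,
    nrm Y (minus (proj1_sig (u (S j))) (proj1_sig (u j))) <= r j /\
    3 * INR j / r j < N /\
    (forall v, carrier Y v -> nrm Y (L k v) <= N * nrm Y v) /\
    5 / 6 * N * r j <= nrm Y (L k (proj1_sig (u (S j)))).
  exact: (proj2_sig (constructive_indefinite_description _ (Hstep j (u j)))).
have Huc j : carrier Y (proj1_sig (u j)) by exact: proj2_sig.
(* A geometric sum of the steps [r j], [r (j + 1)], ..., kept in closed form so that the induction
   can add one more step. *)
have Hgap j m : nrm Y (minus (proj1_sig (u (j + m)%coq_nat)) (proj1_sig (u j)))
    <= 3 / 2 * (r j - r (j + m)%coq_nat).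
  elim: m => [|m IH].
    rewrite Nat.add_0_r.
    have -> : minus (proj1_sig (u j)) (proj1_sig (u j)) = zero by module V.
    by rewrite seminorm_zero; lra.
  rewrite Nat.add_succ_r HrS.
  have [k [N [H1 _]]] := Hu (j + m)%coq_nat.
  set a := proj1_sig (u (S _)) in H1 *; set b := proj1_sig (u (j + m)%coq_nat) in H1 IH.
  have -> : minus a (proj1_sig (u j)) =
      plus (minus a b) (minus b (proj1_sig (u j))) by module V.
  apply: Rle_trans;
    first by apply: (seminorm_triangle HY); apply: carrier_minus; exact: Huc.
  lra.
have [x [Hx Hlim]] : exists x, carrier Y x /\
    forall eps, 0 < eps -> exists N : nat, forall k : nat,
      (N <= k)%coq_nat -> nrm Y (minus (proj1_sig (u k)) x) < eps.
  apply: (HYc (u := fun j => proj1_sig (u j))) => // eps Heps.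
  have [N HrN] := Hr0 (eps / 3) ltac:(lra).
  exists N => k m Hk1 Hm1.
  have Hfar i : (N <= i)%coq_nat ->
      nrm Y (minus (proj1_sig (u i)) (proj1_sig (u N))) < eps / 2.
    move=> Hi; have := Hgap N (Nat.sub i N).
    have -> : (N + Nat.sub i N)%coq_nat = i by lia.
    by have := Hr i; lra.
  have -> : minus (proj1_sig (u k)) (proj1_sig (u m)) =
      minus (minus (proj1_sig (u k)) (proj1_sig (u N)))
            (minus (proj1_sig (u m)) (proj1_sig (u N))) by module V.
  apply: Rle_lt_trans; first by apply: seminorm_minus; exact: carrier_minus.
  by have := Hfar k Hk1; have := Hfar m Hm1; lra.
have Hdist j : nrm Y (minus (proj1_sig (u j)) x) <= 3 / 2 * r j.
  apply: Rnot_lt_le => Hlt.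
  have [N HN] := Hlim (nrm Y (minus (proj1_sig (u j)) x) - 3 / 2 * r j) ltac:(lra).
  have := HN (j + N)%coq_nat ltac:(lia); have := Hgap j N; have := Hr (j + N)%coq_nat.
  set a := proj1_sig (u (j + N)%coq_nat).
  have Ha : carrier Y a by exact: Huc.
  have Hb' : carrier Y (minus a x) by exact: carrier_minus.
  have Hc' : carrier Y (minus a (proj1_sig (u j))) by exact: carrier_minus.
  have := seminorm_minus Hb' Hc'.
  have -> : minus (minus a x) (minus a (proj1_sig (u j))) =
      minus (proj1_sig (u j)) x by module V.
  lra.
have [M HM] := Hpt x Hx.
have [j Hj] : exists j : nat, M < INR j.
  have [j Hj] := INR_unbounded M; by exists j.
have [k [N [_ [HN [HNb Hlow]]]]] := Hu j.
have HLx : nrm Y (L k x) <= M by exact: HM.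
have := Hdist (S j); rewrite HrS => Hd.
set a := proj1_sig (u (S j)) in Hlow Hd.
have Ha : carrier Y a by exact: Huc.
have HLc := (proj1 (HL k)).
have := seminorm_le_plus_minus (HLc _ Ha) (HLc _ Hx).
rewrite -linear_on_minus // => H1.
have H2 := HNb _ (carrier_minus Ha Hx).
have Hrj := Hr j.
have H3 : 3 * INR j < N * r j.
  have -> : 3 * INR j = 3 * INR j / r j * r j by field; lra.
  exact: Rmult_lt_compat_r.
have HNpos : 0 < N by have := pos_INR j; nra.
nra.
Qed.

End Seminorm.

(** * Bounds for a strongly continuous semigroup and its generator *)

Section C0.

Variables (V : ModuleSpace C_Ring) (Y : normed_subspace V).
Hypotheses (HY : is_seminorm Y) (HYc : is_complete Y).
Variable T : R -> V -> V.
Hypothesis HT : C0_semigroup Y T.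

Lemma C0_semigroup_linear t : 0 <= t -> linear_on (carrier Y) (T t).
Proof.
move=> Ht; split; [|split].
- by move=> v; exact: (C0_stable HT).
- by move=> u v; exact: (C0_plus HT).
- by move=> a v; exact: (C0_scal HT).
Qed.

Lemma at_right_0_small (f : R -> R) :
  filterlim f (at_right 0) (locally 0) ->
  forall eps, 0 < eps -> exists d, 0 < d /\ forall t, 0 < t < d -> f t < eps.
Proof.
move=> Hf eps Heps.
have [d Hd] := Hf _ (locally_ball (0 : R) (mkposreal eps Heps)).
exists d; split; first exact: cond_pos.
move=> t [Ht0 Htd].
have : ball (0 : R) eps (f t).
  apply: Hd => //; rewrite /ball /= /AbsRing_ball /abs /minus /plus /opp /=.
  by rewrite Rabs_pos_eq; lra.
rewrite /ball /= /AbsRing_ball /abs /minus /plus /opp /= => H.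
by have := Rle_abs (f t + - 0); lra.
Qed.

Lemma bounded_of_eventually_bounded (f : nat -> R) (N : nat) (M : R) :
  (forall k, (N <= k)%coq_nat -> f k <= M) -> exists M', forall k, f k <= M'.
Proof.
elim: N M => [|N IH] M HM; first by exists M => k; apply: HM; lia.
apply: (IH (Rmax M (f N))) => k Hk.
case: (Nat.eq_dec k N) => [->|Hne]; first exact: Rmax_r.
by apply: Rle_trans (Rmax_l _ _); apply: HM; lia.
Qed.

(** Otherwise there are times [tk k] tending to 0 at which no bound [INR k + 1] holds. Along them
    each orbit is bounded, by right continuity at 0, which contradicts uniform boundedness. *)
Lemma C0_semigroup_locally_bounded :
  exists d M, 0 < d /\ 0 < M /\
    forall t v, 0 <= t <= d -> carrier Y v -> nrm Y (T t v) <= M * nrm Y v.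
Proof.
apply: NNPP => Hn.
have Hk (k : nat) : exists t, 0 <= t <= / (INR k + 1) /\
    exists v, carrier Y v /\ (INR k + 1) * nrm Y v < nrm Y (T t v).
  have Hk0 := pos_INR k.
  apply: NNPP => Hk; apply: Hn; exists (/ (INR k + 1)), (INR k + 1).
  split; first by apply: Rinv_0_lt_compat; lra.
  split; first lra.
  move=> t v Ht Hv; apply: Rnot_lt_le => Hlt; apply: Hk.
  by exists t; split=> //; exists v.
pose tk k := proj1_sig (constructive_indefinite_description _ (Hk k)).
have Htk k : 0 <= tk k <= / (INR k + 1) /\
    exists v, carrier Y v /\ (INR k + 1) * nrm Y v < nrm Y (T (tk k) v).
  exact: (proj2_sig (constructive_indefinite_description _ (Hk k))).
have [M HM] : exists M, forall k v, carrier Y v -> nrm Y (T (tk k) v) <= M * nrm Y v.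
  apply: uniform_boundedness => //.
  - by move=> k; apply: C0_semigroup_linear; case: (Htk k) => [[]].
  - by move=> k; apply: (C0_bounded HT); case: (Htk k) => [[]].
  - move=> v Hv.
    have [e [He Hev]] := at_right_0_small (C0_continuous HT Hv) Rlt_0_1.
    have [N HN] := INR_unbounded (/ e).
    apply: (@bounded_of_eventually_bounded _ N (nrm Y v + 1)) => k Hk1.
    have [[Ht0 Ht1] _] := Htk k.
    (* The filter [at_right 0] says nothing about the time 0 itself. *)
    case: (Req_dec (tk k) 0) => [->|Hne]; first by rewrite (C0_zero HT) //; lra.
    have Hte : tk k < e.
      apply: Rle_lt_trans Ht1 _; rewrite -(Rinv_inv e).
      have Hi : 0 < / e by apply: Rinv_0_lt_compat.
      have HkN := le_INR _ _ Hk1.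
      by apply: Rinv_lt_contravar; [apply: Rmult_lt_0_compat|]; lra.
    have Htv : carrier Y (T (tk k) v) by exact: (C0_stable HT).
    by have := seminorm_le_plus_minus HY Htv Hv; have := Hev (tk k) ltac:(lra); lra.
have [k Hk1] := INR_unbounded M.
have [_ [v [Hv Hlt]]] := Htk k.
by have := HM k v Hv; have := seminorm_pos HY Hv; nra.
Qed.

(* Telescoping [T (N h) v - z ^ N v] with [z = 1 + h l] compares the semigroup
   with explicit Euler steps, so that no exponential or integral is needed. *)
Lemma C0_semigroup_euler (d M h : R) (z : C) (v : V) (N : nat) :
  0 < M ->
  (forall t v, 0 <= t <= d -> carrier Y v -> nrm Y (T t v) <= M * nrm Y v) ->
  0 <= h -> INR N * h <= d -> 1 <= Cmod z -> carrier Y v ->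
  nrm Y (minus (T (INR N * h) v) (scal (Cpow z N) v)) <=
    INR N * Cmod z ^ N * M * nrm Y (minus (T h v) (scal z v)).
Proof.
move=> HM Hb Hh HN Hz Hv.
have Hw : carrier Y (minus (T h v) (scal z v)).
  apply: carrier_minus => //; first exact: (C0_stable HT).
  exact: seminorm_carrier_scal.
have Hw0 := seminorm_pos HY Hw.
set w := minus (T h v) (scal z v) in Hw Hw0 *.
elim: N HN => [|N IH] HN.
  rewrite /= Rmult_0_l (C0_zero HT) //.
  have -> : minus v (scal (RtoC 1) v) = zero by module V.
  by rewrite seminorm_zero //; lra.
rewrite S_INR in HN *.
have HN0 := pos_INR N.
have {}IH := IH ltac:(nra).
have HNh : 0 <= INR N * h by exact: Rmult_le_pos.
have -> : (INR N + 1) * h = INR N * h + h by lra.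
rewrite (C0_add HT) //.
have HTv : carrier Y (T (INR N * h) v) by exact: (C0_stable HT).
have -> : T h v = plus (scal z v) w by rewrite /w; module V.
have Hzv : carrier Y (scal z v) by exact: seminorm_carrier_scal.
rewrite (C0_plus HT) // (C0_scal HT) //.
(* One more step multiplies the old error by [z] and adds [T (INR N * h) w], of norm at most
   [M * nrm Y w] because [INR N * h <= d]. As [Cmod z >= 1], the new term fits under the larger
   power of [Cmod z]. *)
have -> : minus (plus (scal z (T (INR N * h) v)) (T (INR N * h) w))
            (scal (Cpow z (S N)) v) =
          plus (scal z (minus (T (INR N * h) v) (scal (Cpow z N) v)))
               (T (INR N * h) w) by module V.
have Hd : carrier Y (minus (T (INR N * h) v) (scal (Cpow z N) v)).
  by apply: carrier_minus => //; exact: seminorm_carrier_scal.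
apply: Rle_trans.
  apply: (seminorm_triangle HY); first exact: seminorm_carrier_scal.
  exact: (C0_stable HT).
rewrite (seminorm_scal HY) //.
have HTw := Hb (INR N * h) w ltac:(nra) Hw.
have Hq : 1 <= Cmod z ^ N by exact: pow_R1_Rle.
have H1 : Cmod z * nrm Y (minus (T (INR N * h) v) (scal (Cpow z N) v)) <=
    Cmod z * (INR N * Cmod z ^ N * M * nrm Y w).
  by apply: Rmult_le_compat_l => //; lra.
have H2 : M * nrm Y w <= Cmod z * Cmod z ^ N * (M * nrm Y w).
  have H3 : 1 <= Cmod z * Cmod z ^ N by nra.
  have H4 : 0 <= M * nrm Y w by apply: Rmult_le_pos; lra.
  by nra.
rewrite /=; nra.
Qed.

(** Over the time [d] the Euler steps compare [T d v] with [z ^ N v], where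
    [Cmod z ^ N >= 1 + d * Re l >= 1 + 2 * M], whereas [T d v] has norm at most [M * nrm Y v]. A
    residual below [nrm Y v / (2 * d * M)] makes these incompatible; [K] and [om] are read off from
    this. *)
Lemma C0_semigroup_resolvent_bound :
  exists K om, 0 < K /\
    forall (l : C) v w, carrier Y v -> carrier Y w ->
      filterlim
        (fun h => nrm Y (minus (scal (RtoC (/ h)) (minus (T h v) v)) w))
        (at_right 0) (locally 0) ->
      om <= Re l ->
      nrm Y v <= K * nrm Y (minus w (scal l v)).
Proof.
have [d [M [Hd [HM Hb]]]] := C0_semigroup_locally_bounded.
exists (2 * d * M), (2 * M / d); split; first nra.
move=> l v w Hv Hw Hlim Hl.
have Hlv : carrier Y (scal l v) by exact: seminorm_carrier_scal.
have He : carrier Y (minus w (scal l v)) by exact: carrier_minus.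
set e := minus w (scal l v) in He *.
have He0 := seminorm_pos HY He; have Hv0 := seminorm_pos HY Hv.
apply: Rnot_lt_le => Hlt.
have HdM : 0 < 2 * d * M by nra.
(* With this slack [d * M * (eta + nrm Y e)] is exactly half of [nrm Y v], so the Euler error is at
   most half of [Cmod z ^ N * nrm Y v]. *)
pose eta := nrm Y v / (2 * d * M) - nrm Y e.
have Heta : 0 < eta.
  rewrite /eta; have : nrm Y e < nrm Y v / (2 * d * M); last lra.
  by apply/Rlt_div_r; lra.
have [h0 [Hh0 Hh]] := at_right_0_small Hlim Heta.
have [N HN] := INR_unbounded (d / h0).
have Hdh : 0 < d / h0 by apply: Rdiv_lt_0_compat.
pose h := d / INR N.
have Hhpos : 0 < h by apply: Rdiv_lt_0_compat => //; lra.
have Hhlt : h < h0.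
  rewrite /h; apply/Rlt_div_l; first lra.
  by move: HN => /Rlt_gt /Rlt_div_l; lra.
have HNh : INR N * h = d by rewrite /h; field; lra.
have {}Hh := Hh h (conj Hhpos Hhlt).
pose z := Cplus (RtoC 1) (Cmult (RtoC h) l).
have HMd : 0 < 2 * M / d by apply: Rdiv_lt_0_compat; lra.
have Hz : 1 + h * Re l <= Cmod z.
  apply: Rle_trans (re_le_Cmod _); apply: Rle_trans (Rle_abs _).
  by rewrite /z; case: (l) => a b /=; lra.
have Hhl : 0 < h * Re l by apply: Rmult_lt_0_compat; lra.
have HTh : carrier Y (T h v) by apply: (C0_stable HT) => //; lra.
have Hw' : nrm Y (minus (T h v) (scal z v)) <= h * (eta + nrm Y e).
  have -> : minus (T h v) (scal z v) = scal (RtoC h)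
      (plus (minus (scal (RtoC (/ h)) (minus (T h v) v)) w) e).
    by rewrite /e /z; module V; apply: injective_projections => /=; field; lra.
  have H1 : carrier Y (minus (scal (RtoC (/ h)) (minus (T h v) v)) w).
    apply: carrier_minus => //; apply: seminorm_carrier_scal => //.
    exact: carrier_minus.
  rewrite (seminorm_scal HY); last exact: seminorm_carrier_plus.
  rewrite Cmod_R Rabs_pos_eq; last lra.
  apply: Rmult_le_compat_l; first lra.
  apply: Rle_trans (seminorm_triangle HY H1 He) _.
  by apply: Rplus_le_compat_r; exact: Rlt_le.
have Heu := C0_semigroup_euler (N := N) (z := z) (h := h) (v := v) HM Hb
  ltac:(lra) ltac:(lra) ltac:(lra) Hv.
rewrite HNh in Heu.
have HTd := Hb d v ltac:(lra) Hv.
have HTdc : carrier Y (T d v) by apply: (C0_stable HT) => //; lra.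
have Hzv : carrier Y (scal (Cpow z N) v) by exact: seminorm_carrier_scal.
have H2 := seminorm_le_plus_minus HY Hzv HTdc.
rewrite (seminorm_sym HY) // (seminorm_scal HY) // in H2.
have Hpow : Cmod (Cpow z N) = Cmod z ^ N.
  by elim: (N) => [|k IH] /=; rewrite ?Cmod_1 // Cmod_mult IH.
rewrite Hpow in H2.
(* Bernoulli's inequality, with [INR N * h = d] and the threshold [2 * M / d] for [Re l]. *)
have Hq : 1 + 2 * M <= Cmod z ^ N.
  have H5 : (1 + h * Re l) ^ N <= Cmod z ^ N by apply: pow_incr; lra.
  have := poly N _ Hhl; rewrite -Rmult_assoc HNh.
  have H6 : 2 * M <= Re l * d by apply/Rle_div_l.
  lra.
set q := Cmod z ^ N in Heu H2 Hq.
have H3 : INR N * q * M * nrm Y (minus (T h v) (scal z v)) <=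
    INR N * q * M * (h * (eta + nrm Y e)).
  apply: Rmult_le_compat_l => //.
  by have := pos_INR N; move=> ?; apply: Rmult_le_pos; [apply: Rmult_le_pos|]; lra.
have H4 : INR N * q * M * (h * (eta + nrm Y e)) = q * (nrm Y v / 2).
  have -> : INR N * q * M * (h * (eta + nrm Y e)) =
    (INR N * h) * q * M * (eta + nrm Y e) by ring.
  by rewrite HNh /eta; field; lra.
nra.
Qed.

End C0.

(** * Self-adjoint positive operators *)

(** Source of every Cauchy-Schwarz inequality below, for the inner product as well as for
    non-negative forms that may degenerate; hence [c = 0] is allowed. *)
Lemma discriminant_le (a b c : R) : 0 <= c ->
  (forall t, 0 <= a + 2 * t * b + t ^ 2 * c) -> b ^ 2 <= a * c.
Proof.
move=> Hc H; case: (Req_dec c 0) => Hc0.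
  case: (Req_dec b 0) => Hb; first by rewrite Hc0 Hb; lra.
  (* With [c = 0] the polynomial is affine, and this is the point where it takes the value -1. *)
  have := H (- (a + 1) / (2 * b)); rewrite Hc0.
  have -> : a + 2 * (- (a + 1) / (2 * b)) * b + (- (a + 1) / (2 * b)) ^ 2 * 0 = -1.
    by field.
  lra.
have := H (- b / c).
have -> : a + 2 * (- b / c) * b + (- b / c) ^ 2 * c = (a * c - b ^ 2) / c by field.
move=> H1; have H2 : 0 <= (a * c - b ^ 2) / c * c by apply: Rmult_le_pos; lra.
have H3 : (a * c - b ^ 2) / c * c = a * c - b ^ 2 by field.
lra.
Qed.

Lemma le_of_sq_le (a b : R) : 0 <= b -> a ^ 2 <= b ^ 2 -> a <= b.
Proof. by move=> Hb H; apply: Rnot_lt_le => Hlt; nra. Qed.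

Section RealInner.

Variable X : HilbertSpace.
Implicit Types x y z : X.

(** The real part of the inner product is symmetric, bilinear over the reals and induces the same
    norm, so that estimates and integrals can be carried out over the reals. *)
Definition rin x y : R := Re (inner x y).

Lemma rin_sym x y : rin x y = rin y x.
Proof. by rewrite /rin (inner_conj x y); case: (inner x y). Qed.

Lemma rin_plus_l x y z : rin (plus x y) z = rin x z + rin y z.
Proof. by rewrite /rin inner_plus. Qed.

Lemma rin_scal_l (a : R) x y : rin (scal (RtoC a) x) y = a * rin x y.
Proof. by rewrite /rin inner_scal; case: (inner x y) => u v /=; ring. Qed.

Lemma rin_minus_l x y z : rin (minus x y) z = rin x z - rin y z.
Proof.
have -> : minus x y = plus x (scal (RtoC (-1)) y) by module X.
by rewrite rin_plus_l rin_scal_l; ring.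
Qed.

Lemma rin_plus_r x y z : rin x (plus y z) = rin x y + rin x z.
Proof. by rewrite !(rin_sym x) rin_plus_l. Qed.

Lemma rin_scal_r (a : R) x y : rin x (scal (RtoC a) y) = a * rin x y.
Proof. by rewrite !(rin_sym x) rin_scal_l. Qed.

Lemma rin_minus_r x y z : rin x (minus y z) = rin x y - rin x z.
Proof. by rewrite !(rin_sym x) rin_minus_l. Qed.

Lemma rin_self x : rin x x = norm x ^ 2.
Proof. by rewrite /rin inner_self. Qed.

Lemma rin_cauchy_schwarz x y : Rabs (rin x y) <= norm x * norm y.
Proof.
have Hx := norm_ge_0 x; have Hy := norm_ge_0 y.
apply: le_of_sq_le; first exact: Rmult_le_pos.
rewrite pow2_abs Rpow_mult_distr.
apply: discriminant_le; first exact: pow2_ge_0.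
move=> t; have <- : rin (plus x (scal (RtoC t) y)) (plus x (scal (RtoC t) y)) =
    norm x ^ 2 + 2 * t * rin x y + t ^ 2 * norm y ^ 2.
  rewrite !rin_plus_l !rin_plus_r !rin_scal_l !rin_scal_r !rin_self (rin_sym y x).
  ring.
by rewrite rin_self; exact: pow2_ge_0.
Qed.

Lemma rin_le x y : rin x y <= norm x * norm y.
Proof. exact: Rle_trans (Rle_abs _) (rin_cauchy_schwarz x y). Qed.

Lemma norm_scal_C (a : C) x : norm (scal a x) = Cmod a * norm x.
Proof.
apply: Rsqr_inj; [exact: norm_ge_0| |].
  by apply: Rmult_le_pos; [exact: Cmod_ge_0|exact: norm_ge_0].
rewrite !Rsqr_pow2 -rin_self Rpow_mult_distr.
rewrite /rin inner_scal (inner_conj (scal a x) x) inner_scal inner_self.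
rewrite /Cmod pow2_sqrt; last by apply: Rplus_le_le_0_compat; exact: pow2_ge_0.
by case: a => u v /=; ring.
Qed.

Lemma norm_scal_real (a : R) x : norm (scal (RtoC a) x) = Rabs a * norm x.
Proof. by rewrite norm_scal_C Cmod_R. Qed.

Lemma norm_minus_sym x y : norm (minus x y) = norm (minus y x).
Proof.
have -> : minus x y = scal (RtoC (-1)) (minus y x) by module X.
by rewrite norm_scal_real Rabs_left; lra.
Qed.

Lemma norm_minus_le x y : norm (minus x y) <= norm x + norm y.
Proof.
have -> : minus x y = plus x (scal (RtoC (-1)) y) by module X.
apply: Rle_trans; first exact: norm_triangle.
by rewrite norm_scal_real Rabs_left; lra.
Qed.

Lemma norm_le_minus_plus x y : norm x <= norm (minus x y) + norm y.
Proof.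
by have {1}-> : x = plus (minus x y) y by [module X]; exact: norm_triangle.
Qed.

Lemma norm_minus_triangle x y z :
  norm (minus x z) <= norm (minus x y) + norm (minus y z).
Proof.
have -> : minus x z = plus (minus x y) (minus y z) by module X.
exact: norm_triangle.
Qed.

Lemma eq_of_norm_minus x y : norm (minus x y) <= 0 -> x = y.
Proof.
move=> H; have H0 : minus x y = zero.
  by apply: norm_eq_zero; have := norm_ge_0 (minus x y); lra.
have -> : x = plus (minus x y) y by module X.
by rewrite H0 plus_zero_l.
Qed.

(** Tested on domain vectors close to [w] itself, the hypothesis becomes [norm w ^ 2 <= c * norm w]
    in the limit. *)
Lemma densely_defined_norm_le (A : operator X) (w : X) (c : R) :
  densely_defined A -> 0 <= c ->
  (forall z, dom A z -> rin w z <= c * norm z) -> norm w <= c.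
Proof.
move=> Hd Hc H; apply: Rnot_lt_le => Hlt.
have Hcw : 0 < c + norm w by lra.
(* A test vector within [d] of [w] yields [norm w * (norm w - c) <= d * (c + norm w)]; this [d]
   makes the right side half of the left. *)
have [d [Hd0 Hdc]] : exists d, 0 < d /\ d * (c + norm w) = norm w * (norm w - c) / 2.
  exists (norm w * (norm w - c) / (2 * (c + norm w))); split; last by field; lra.
  apply: Rdiv_lt_0_compat; last lra.
  by apply: Rmult_lt_0_compat; lra.
have [z [Hz Hzw]] := Hd w d Hd0.
have H1 := H z Hz.
have H2 : norm z <= norm w + d by have := norm_le_minus_plus z w; lra.
have H3 : rin w (minus w z) <= norm w * d.
  apply: Rle_trans (rin_le _ _) _; apply: Rmult_le_compat_l; first lra.
  by rewrite norm_minus_sym; lra.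
rewrite rin_minus_r rin_self in H3.
nra.
Qed.

End RealInner.

(** * Resolvents and approximate eigenvectors of a positive self-adjoint operator *)

Section PositiveOperator.

Variables (X : HilbertSpace) (A : operator X).
Hypotheses (Alin : linear_operator A) (Adense : densely_defined A)
  (Asa : self_adjoint A) (Apos : positive_definite A)
  (Aspec : exists l0 : R, 0 < l0 /\ forall l : C, spectrum A l -> l0 < Re l).

Lemma A_symmetric x y : dom A x -> dom A y -> rin (app A x) y = rin x (app A y).
Proof.
move=> Hx Hy; rewrite /rin.
by have [_ ->] := Asa y (app A y).
Qed.

Lemma dom_A_plus x y : dom A x -> dom A y ->
  dom A (plus x y) /\ app A (plus x y) = plus (app A x) (app A y).
Proof. by have [_ [Hp _]] := Alin; exact: Hp. Qed.

Lemma dom_A_scal (a : C) x : dom A x ->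
  dom A (scal a x) /\ app A (scal a x) = scal a (app A x).
Proof. by have [_ [_ Hs]] := Alin; exact: Hs. Qed.

Lemma dom_A_minus x y : dom A x -> dom A y ->
  dom A (minus x y) /\ app A (minus x y) = minus (app A x) (app A y).
Proof.
move=> Hx Hy; have [Hd He] := dom_A_scal (RtoC (-1)) Hy.
have -> : minus x y = plus x (scal (RtoC (-1)) y) by module X.
have [Hd' He'] := dom_A_plus Hx Hd; split=> //.
by rewrite He' He; module X.
Qed.

Lemma A_zero : app A zero = zero.
Proof.
have [H0 _] := Alin.
have [_ H] := dom_A_scal (RtoC 0) H0.
have E1 : scal (RtoC 0) (zero : X) = zero by module X.
by rewrite E1 in H; rewrite H; module X.
Qed.

Lemma A_nonneg x : dom A x -> 0 <= rin (app A x) x.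
Proof.
move=> Hx; case: (classic (x = zero)) => [->|Hne].
  by rewrite A_zero rin_self; exact: pow2_ge_0.
by apply: Rlt_le; exact: Apos.
Qed.

(** The cross term [2 * l * rin (app A z) z] of the expanded square is non-negative, so each of the
    two squares is bounded by the whole. *)
Lemma shifted_norm (l : R) z : 0 <= l -> dom A z ->
  norm (app A z) <= norm (plus (scal (RtoC l) z) (app A z)) /\
  l * norm z <= norm (plus (scal (RtoC l) z) (app A z)).
Proof.
move=> Hl Hz.
have Hn := norm_ge_0 z; have Hpos := A_nonneg Hz.
have H : norm (plus (scal (RtoC l) z) (app A z)) ^ 2 =
    l ^ 2 * norm z ^ 2 + 2 * l * rin (app A z) z + norm (app A z) ^ 2.
  rewrite -!rin_self !rin_plus_l !rin_plus_r !rin_scal_l !rin_scal_r.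
  by rewrite (rin_sym z (app A z)); ring.
have H1 : 0 <= l * rin (app A z) z by exact: Rmult_le_pos.
have H2 := pow2_ge_0 (l * norm z); have H3 := pow2_ge_0 (norm (app A z)).
by split; apply: le_of_sq_le; try exact: norm_ge_0; rewrite H; nra.
Qed.

Lemma resolvent_nonpos (l : R) : 0 <= l -> resolvent_set A (RtoC (- l)).
Proof.
move=> Hl; apply: NNPP => Hn.
have [l0 [Hl0 H]] := Aspec.
by have := H _ Hn; rewrite /=; lra.
Qed.

(** The spectral gap puts 0 in the resolvent set. With the convention [l - A], the operator [B]
    found there inverts [- A], whence the factor -1. *)
Lemma A_coercive : exists M, 0 < M /\ forall z, dom A z -> norm z <= M * norm (app A z).
Proof.
have [B [_ [HB [M HM]]]] := resolvent_nonpos (Rle_refl 0).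
exists (Rabs M + 1); split; first by have := Rabs_pos M; lra.
move=> z Hz; have {1}-> : z = B (scal (RtoC (-1)) (app A z)).
  rewrite -{1}(HB z Hz); congr (B _).
  by rewrite Ropp_0; module X.
apply: Rle_trans (HM _) _; rewrite norm_scal_real Rabs_left; last lra.
by have := Rle_abs M; have := norm_ge_0 (app A z); nra.
Qed.

(** Coercivity and the first bound of [shifted_norm] treat [l = 0] together with [l > 0]. *)
Lemma shift_injective (l : R) y z : 0 <= l -> dom A y -> dom A z ->
  plus (scal (RtoC l) y) (app A y) = plus (scal (RtoC l) z) (app A z) -> y = z.
Proof.
move=> Hl Hy Hz Heq.
have [M [HM0 HM]] := A_coercive.
have [Hd Hm] := dom_A_minus Hy Hz.
apply: eq_of_norm_minus.
apply: Rle_trans (HM _ Hd) _.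
have [H1 _] := shifted_norm Hl Hd.
have E : plus (scal (RtoC l) (minus y z)) (app A (minus y z)) = zero.
  rewrite Hm.
  have -> : plus (scal (RtoC l) (minus y z)) (minus (app A y) (app A z)) =
    minus (plus (scal (RtoC l) y) (app A y)) (plus (scal (RtoC l) z) (app A z)) by module X.
  by rewrite Heq; module X.
by rewrite E norm_zero in H1; nra.
Qed.

Lemma shift_inv_spec (l : R) x : 0 <= l ->
  dom A (shift_inv A l x) /\
  plus (scal (RtoC l) (shift_inv A l x)) (app A (shift_inv A l x)) = x.
Proof.
move=> Hl; rewrite /shift_inv; apply: (iota_correct (fun z : X =>
  dom A z /\ plus (scal (RtoC l) z) (app A z) = x)).
(* [B] inverts [- l - A], so the solution of the shifted equation is [- B x]. *)
have [B [HB _]] := resolvent_nonpos Hl.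
have [Hd He] := HB x.
have [Hd' He'] := dom_A_scal (RtoC (-1)) Hd.
have Hx : plus (scal (RtoC l) (scal (RtoC (-1)) (B x)))
              (app A (scal (RtoC (-1)) (B x))) = x.
  by rewrite He' -[RHS]He; module X.
exists (scal (RtoC (-1)) (B x)); split=> // y [Hy Hy'].
by apply: (shift_injective Hl) => //; rewrite Hx Hy'.
Qed.

Lemma shift_inv_unique (l : R) x z : 0 <= l -> dom A z ->
  plus (scal (RtoC l) z) (app A z) = x -> shift_inv A l x = z.
Proof.
move=> Hl Hz Hx; have [Hd He] := shift_inv_spec x Hl.
by apply: (shift_injective Hl) => //; rewrite He Hx.
Qed.

Definition A_inv (x : X) : X := shift_inv A 0 x.

Lemma dom_A_inv x : dom A (A_inv x).
Proof. by have [] := shift_inv_spec x (Rle_refl 0). Qed.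

Lemma A_invK x : app A (A_inv x) = x.
Proof.
have [_ H] := shift_inv_spec x (Rle_refl 0).
by rewrite -[RHS]H /A_inv; module X.
Qed.

Lemma A_inv_minus x y : A_inv (minus x y) = minus (A_inv x) (A_inv y).
Proof.
have [Hd He] := dom_A_minus (dom_A_inv x) (dom_A_inv y).
apply: shift_inv_unique => //; first lra.
by rewrite He !A_invK; module X.
Qed.

Lemma A_inv_scal (a : C) x : A_inv (scal a x) = scal a (A_inv x).
Proof.
have [Hd He] := dom_A_scal a (dom_A_inv x).
apply: shift_inv_unique => //; first lra.
by rewrite He !A_invK; module X.
Qed.

Lemma A_inv_symmetric x y : rin (A_inv x) y = rin x (A_inv y).
Proof.
rewrite -{1}(A_invK y) -{2}(A_invK x) A_symmetric //; exact: dom_A_inv.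
Qed.

(** Cauchy-Schwarz for the non-negative form [rin (app A y) z] bounds it by [c * norm y * norm z] on
    the domain; density then turns this into a bound for [app A y]. *)
Lemma bounded_of_form_bound (c : R) : 0 <= c ->
  (forall y, dom A y -> rin (app A y) y <= c * norm y ^ 2) -> bounded_operator A.
Proof.
move=> Hc H; exists c => y Hy.
have Hny := norm_ge_0 y.
apply: (densely_defined_norm_le Adense); first exact: Rmult_le_pos.
move=> z Hz.
have Hnz := norm_ge_0 z.
have H1 : rin (app A y) z ^ 2 <= rin (app A y) y * rin (app A z) z.
  apply: discriminant_le; first exact: A_nonneg.
  move=> t; have [Hd1 He1] := dom_A_scal (RtoC t) Hz.
  have [Hd2 He2] := dom_A_plus Hy Hd1.
  have := A_nonneg Hd2; rewrite He2 He1.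
  rewrite !rin_plus_l !rin_plus_r !rin_scal_l !rin_scal_r.
  by rewrite (A_symmetric Hz Hy) (rin_sym z); lra.
apply: le_of_sq_le; first by apply: Rmult_le_pos => //; exact: Rmult_le_pos.
apply: Rle_trans H1 _.
have -> : (c * norm y * norm z) ^ 2 = (c * norm y ^ 2) * (c * norm z ^ 2) by ring.
by apply: Rmult_le_compat; try exact: A_nonneg; exact: H.
Qed.

(* The quadratic form [eps <Ex, x> - |Ex|^2] of [E = A_inv] is that of the
   polynomial [t (eps - t)], which vanishes at 0 and is positive only on
   (0, eps): maximizing it produces spectrum of [E] near, but not at, 0. *)
Lemma approximate_quadratic_root (eps : R) : ~ bounded_operator A -> 0 < eps ->
  exists s, 0 < s <= eps ^ 2 / 4 /\
    forall eta, 0 < eta -> exists x, 0 < norm x /\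
      norm (plus (minus (scal (RtoC s) x) (scal (RtoC eps) (A_inv x)))
                 (A_inv (A_inv x))) <= eta * norm x.
Proof.
move=> Hunb Heps.
pose Q x := eps * rin (A_inv x) x - norm (A_inv x) ^ 2.
(* Completing the square: the difference of the two sides is the squared norm of
   [A_inv x - (eps / 2) x]. *)
have HQ x : Q x <= eps ^ 2 / 4 * norm x ^ 2.
  have := pow2_ge_0 (norm (minus (A_inv x) (scal (RtoC (eps / 2)) x))).
  rewrite -rin_self rin_minus_l !rin_minus_r !rin_scal_l !rin_scal_r.
  by rewrite (rin_sym x) !rin_self /Q; nra.
have HQs (a : R) x : Q (scal (RtoC a) x) = a ^ 2 * Q x.
  rewrite /Q A_inv_scal rin_scal_l rin_scal_r norm_scal_real Rpow_mult_distr.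
  by rewrite pow2_abs; ring.
(* Unboundedness of [A] enters here: if [Q <= 0] throughout, then at [app A y] this reads
   [rin (app A y) y <= / eps * norm y ^ 2], and [A] would be bounded. *)
have [x0 Hx0] : exists x, 0 < Q x.
  apply: NNPP => Hn; apply: Hunb; apply: (@bounded_of_form_bound (/ eps)).
    by apply: Rlt_le; exact: Rinv_0_lt_compat.
  move=> y Hy; apply: Rnot_lt_le => Hlt; apply: Hn; exists (app A y).
  have E : A_inv (app A y) = y.
    by apply: shift_inv_unique => //; [lra|module X].
  rewrite /Q E rin_sym.
  have : norm y ^ 2 = eps * (/ eps * norm y ^ 2) by field; lra.
  by nra.
pose S c := exists x, norm x <= 1 /\ c = Q x.
have HSb : is_upper_bound S (eps ^ 2 / 4).
  move=> c [x [Hx ->]]; apply: Rle_trans (HQ x) _.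
  have H0 : norm x ^ 2 <= 1 by have := norm_ge_0 x; nra.
  by have := pow2_ge_0 eps; nra.
have [s [Hs1 Hs2]] : {s | is_lub S s}.
  apply: completeness; first by exists (eps ^ 2 / 4).
  by exists (Q zero), zero; split=> //; rewrite norm_zero; lra.
have HQle x : Q x <= s * norm x ^ 2.
  have Hx := norm_ge_0 x.
  case: (Req_dec (norm x) 0) => Hx1.
    by apply: Rle_trans (HQ x) _; rewrite Hx1; lra.
  have Hi : 0 < / norm x by apply: Rinv_0_lt_compat; lra.
  have /Hs1 : S (Q (scal (RtoC (/ norm x)) x)).
    exists (scal (RtoC (/ norm x)) x); split=> //.
    by rewrite norm_scal_real Rabs_pos_eq ?Rinv_l; lra.
  rewrite HQs => H.
  have -> : Q x = (/ norm x) ^ 2 * Q x * norm x ^ 2 by field.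
  by apply: Rmult_le_compat_r => //; exact: pow2_ge_0.
have Hspos : 0 < s.
  by have := HQle x0; have := pow2_ge_0 (norm x0); nra.
exists s; split; first by split=> //; exact: Hs2.
have [M [HM0 HM]] := A_coercive.
have HE x : norm (A_inv x) <= M * norm x.
  by have := HM _ (dom_A_inv x); rewrite A_invK.
(* The operator [s - eps E + E^2] of the form [s |x|^2 - Q x], which is non-negative because [s] is
   the supremum of [Q] on the unit ball. *)
pose F x := plus (minus (scal (RtoC s) x) (scal (RtoC eps) (A_inv x)))
                 (A_inv (A_inv x)).
pose K := s + eps * M + M ^ 2.
have HK : 0 < K by have := pow_lt M 2 HM0; rewrite /K; nra.
have HF x : norm (F x) <= K * norm x.
  rewrite /F; apply: Rle_trans (norm_triangle _ _) _.
  apply: Rle_trans (Rplus_le_compat_r _ _ _ (norm_minus_le _ _)) _.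
  rewrite !norm_scal_real !Rabs_pos_eq; try lra.
  have H1 : eps * norm (A_inv x) <= eps * (M * norm x).
    by apply: Rmult_le_compat_l; [lra|exact: HE].
  have H2 : norm (A_inv (A_inv x)) <= M * (M * norm x).
    by apply: Rle_trans (HE _) _; apply: Rmult_le_compat_l; [lra|exact: HE].
  rewrite /K; lra.
have HFs x y : rin (F x) y = rin x (F y).
  rewrite /F rin_plus_l rin_minus_l rin_plus_r rin_minus_r !rin_scal_l !rin_scal_r.
  by rewrite !A_inv_symmetric.
have HFQ x : rin (F x) x = s * norm x ^ 2 - Q x.
  rewrite /F rin_plus_l rin_minus_l !rin_scal_l rin_self.
  by rewrite (A_inv_symmetric (A_inv x)) rin_self /Q; ring.
have HFpos x : 0 <= rin (F x) x by rewrite HFQ; have := HQle x; lra.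
(* Cauchy-Schwarz for the form of [F], applied to [x] and [F x]: a near-maximizer of [Q] is almost
   in the kernel of [F]. *)
have HFcs x : norm (F x) ^ 2 <= K * rin (F x) x.
  have Hn := norm_ge_0 (F x).
  have H1 : rin (F x) (F x) ^ 2 <= rin (F x) x * rin (F (F x)) (F x).
    apply: discriminant_le => // t.
    have H := HFpos (plus x (scal (RtoC t) (F x))).
    rewrite HFs rin_plus_l rin_scal_l -!HFs !rin_plus_r !rin_scal_r in H.
    by rewrite (HFs (F x) x) in H; lra.
  rewrite rin_self in H1.
  have H2 : rin (F (F x)) (F x) <= K * norm (F x) ^ 2.
    apply: Rle_trans (rin_le _ _) _; have := HF (F x); nra.
  case: (Req_dec (norm (F x)) 0) => H0.
    by rewrite H0; have := HFpos x; nra.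
  have H3 : 0 < norm (F x) ^ 2 by apply: pow_lt; lra.
  have H4 := HFpos x.
  apply: (Rmult_le_reg_r _ _ _ H3); nra.
move=> eta Heta.
(* The bound [s / 2] keeps the near-maximizer away from 0, with [norm x ^ 2 >= 1 / 2]; the second
   bound equals [eta ^ 2 / (2 * K)] and gives [K * d <= eta ^ 2 / 2]. *)
pose d := Rmin (s / 2) (s * eta ^ 2 / (2 * K) / s).
have Heta2 : 0 < eta ^ 2 by exact: pow_lt.
have Hd2 : 0 < s * eta ^ 2 / (2 * K) / s.
  apply: Rdiv_lt_0_compat => //; apply: Rdiv_lt_0_compat; nra.
have Hd : 0 < d by apply: Rmin_pos; lra.
have Hds : d <= s / 2 by exact: Rmin_l.
have HdK : d <= eta ^ 2 / (2 * K).
  have -> : eta ^ 2 / (2 * K) = s * eta ^ 2 / (2 * K) / s by field; lra.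
  exact: Rmin_r.
have [x [Hx1 Hx2]] : exists x, norm x <= 1 /\ s - d < Q x.
  apply: NNPP => Hn; have : s <= s - d; last lra.
  apply: Hs2 => c [x [Hx ->]]; apply: Rnot_lt_le => Hlt; apply: Hn; by exists x.
have Hx0' := norm_ge_0 x.
have Hx3 : 1 / 2 <= norm x ^ 2.
  have := HQle x => H5.
  apply: (Rmult_le_reg_l _ _ _ Hspos); lra.
have Hx4 : norm x ^ 2 <= 1 by nra.
exists x; split; first nra.
apply: le_of_sq_le; first by apply: Rmult_le_pos; lra.
apply: Rle_trans (HFcs x) _.
have H6 : rin (F x) x <= d by rewrite HFQ; nra.
have H7 : K * d <= eta ^ 2 / 2.
  have -> : eta ^ 2 / 2 = K * (eta ^ 2 / (2 * K)) by field; lra.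
  by apply: Rmult_le_compat_l; lra.
have -> : (eta * norm x) ^ 2 = eta ^ 2 * norm x ^ 2 by ring.
nra.
Qed.

(** With [E = A_inv], the operator [s - eps E + E^2] factors as [(E - nu1) (E - nu2)] with both
    roots in [(0, eps]]. For [x] almost in its kernel, either [x] or [(E - nu2) x] is an approximate
    eigenvector of [E]; its image under [E] is one of [A], for the value [/ nu >= / eps]. *)
Lemma approximate_large_eigenvalue : ~ bounded_operator A ->
  forall m eta, 0 < eta -> exists mu x,
    m <= mu /\ 0 < mu /\ dom A x /\ 0 < norm x /\
    norm (minus (app A x) (scal (RtoC mu) x)) <= eta * norm x.
Proof.
move=> Hunb m eta Heta.
pose eps := / Rmax m 1.
have Hmax : 1 <= Rmax m 1 by exact: Rmax_r.
have Heps : 0 < eps by apply: Rinv_0_lt_compat; lra.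
have [s [[Hs0 Hs1] Hs]] := approximate_quadratic_root Hunb Heps.
pose r := sqrt (eps ^ 2 - 4 * s).
have Hr2 : r ^ 2 = eps ^ 2 - 4 * s by apply: pow2_sqrt; lra.
have Hr0 : 0 <= r by exact: sqrt_pos.
have Hreps : r < eps by apply: Rnot_le_lt => H; nra.
pose nu1 := (eps + r) / 2; pose nu2 := (eps - r) / 2.
have Hnu2 : 0 < nu2 by rewrite /nu2; lra.
have Hnu12 : nu2 <= nu1 by rewrite /nu1 /nu2; lra.
have Hnu1 : nu1 <= eps by rewrite /nu1; lra.
have Hsum : nu1 + nu2 = eps by rewrite /nu1 /nu2; lra.
have Hprod : nu1 * nu2 = s by rewrite /nu1 /nu2; nra.
(* The bound [nu2 / 2] ensures [norm (A_inv u) >= nu * norm u / 2]; the other makes the final error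
   factor [2 * k / nu ^ 2] at most [eta]. *)
pose k := Rmin (nu2 / 2) (eta * nu2 ^ 2 / 2).
have Hnu22 : 0 < nu2 ^ 2 by exact: pow_lt.
have Hk : 0 < k by apply: Rmin_pos; nra.
have Hk1 : k <= nu2 / 2 by exact: Rmin_l.
have Hk2 : k <= eta * nu2 ^ 2 / 2 by exact: Rmin_r.
have [nu [u [Hnul [Hnuh [Hu HEu]]]]] : exists nu u, nu2 <= nu /\ nu <= eps /\
    0 < norm u /\ norm (minus (A_inv u) (scal (RtoC nu) u)) <= k * norm u.
  (* With the square, [norm w > k * norm x] turns a residual of at most [k ^ 2 * norm x] into one of
     at most [k * norm w]. *)
  have [x [Hx HFx]] := Hs (k ^ 2) ltac:(by apply: pow_lt).
  pose w := minus (A_inv x) (scal (RtoC nu2) x).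
  have Hw0 := norm_ge_0 w.
  case: (Rle_dec (norm w) (k * norm x)) => Hw.
    by exists nu2, x; split; [lra|split; [lra|]].
  exists nu1, w; split; first lra; split; first lra.
  split; first nra.
  have -> : minus (A_inv w) (scal (RtoC nu1) w) =
      plus (minus (scal (RtoC s) x) (scal (RtoC eps) (A_inv x))) (A_inv (A_inv x)).
    by rewrite -Hsum -Hprod /w A_inv_minus A_inv_scal; module X.
  by apply: Rle_trans HFx _; nra.
pose y := A_inv u.
have HAy : app A y = u by exact: A_invK.
have Hnu : 0 < nu by lra.
have Huy : norm u <= 2 / nu * norm y.
  have H1 := norm_le_minus_plus (scal (RtoC nu) u) y.
  rewrite norm_scal_real Rabs_pos_eq in H1; last lra.
  rewrite norm_minus_sym in H1.
  have H2 : nu * norm u <= 2 * norm y by rewrite /y in H1 *; nra.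
  apply: (Rmult_le_reg_l _ _ _ Hnu).
  by have -> : nu * (2 / nu * norm y) = 2 * norm y by field; lra.
exists (/ nu), y.
have Hinu : 0 < / nu by exact: Rinv_0_lt_compat.
split.
  apply: Rle_trans (Rmax_l m 1) _; rewrite -(Rinv_inv (Rmax m 1)).
  exact: Rinv_le_contravar.
split=> //; split; first exact: dom_A_inv.
have Hy0 := norm_ge_0 y.
split.
  apply: Rnot_le_lt => H.
  have E : norm y = 0 by lra.
  by rewrite E in Huy; lra.
rewrite HAy.
have -> : minus u (scal (RtoC (/ nu)) y) =
    scal (RtoC (- / nu)) (minus y (scal (RtoC nu) u)).
  by module X; apply: injective_projections => /=; field; lra.
rewrite norm_scal_real Rabs_Ropp Rabs_pos_eq; last lra.
have H3 : / nu * norm (minus y (scal (RtoC nu) u)) <= / nu * (k * (2 / nu * norm y)).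
  apply: Rmult_le_compat_l; first lra.
  by apply: Rle_trans HEu _; apply: Rmult_le_compat_l; lra.
apply: Rle_trans H3 _.
have -> : / nu * (k * (2 / nu * norm y)) = (2 * k / nu ^ 2) * norm y by field; lra.
apply: Rmult_le_compat_r => //.
have Hnusq : 0 < nu ^ 2 by exact: pow_lt.
apply/Rle_div_l => //.
have : nu2 ^ 2 <= nu ^ 2 by apply: pow_incr; lra.
nra.
Qed.

End PositiveOperator.

(** * Improper integrals *)

Lemma Riemann_sum_linear (U W : NormedModule R_AbsRing) (L : U -> W)
    (f : R -> U) (s : SF_seq) :
  is_linear L -> Riemann_sum (fun t => L (f t)) s = L (Riemann_sum f s).
Proof.
move=> HL; case: s => h t; elim: t h => [|p t IH] h.
  by rewrite /Riemann_sum /= (linear_zero L HL).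
have E : mkSF_seq h (p :: t) = SF_cons (h, snd p) (mkSF_seq (fst p) t).
  by rewrite /SF_cons /=; case: (p).
by rewrite E !Riemann_sum_cons IH (linear_plus _ HL) (linear_scal _ HL).
Qed.

Lemma is_RInt_linear (U W : NormedModule R_AbsRing) (L : U -> W)
    (f : R -> U) (a b : R) (z : U) :
  is_linear L -> is_RInt f a b z -> is_RInt (fun t => L (f t)) a b (L z).
Proof.
move=> HL Hf; rewrite /is_RInt.
apply: (filterlim_ext (fun s => L (scal (sign (b - a)) (Riemann_sum f s)))).
  by move=> s; rewrite (linear_scal _ HL) (Riemann_sum_linear _ _ HL).
by apply: filterlim_comp Hf _; exact: linear_cont.
Qed.

Lemma is_RInt_gen_linear (U W : NormedModule R_AbsRing) (L : U -> W)
    (Fa Fb : (R -> Prop) -> Prop) (f : R -> U) (z : U) :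
  is_linear L -> is_RInt_gen f Fa Fb z ->
  is_RInt_gen (fun t => L (f t)) Fa Fb (L z).
Proof.
move=> HL Hf P HP.
have := Hf (fun y => P (L y)) (linear_cont L z HL P HP).
rewrite /filtermapi /=.
case=> Q S HQ HS H; apply: (Filter_prod _ _ _ _ _ HQ HS) => x y Hx Hy.
have [w [Hw1 Hw2]] := H x y Hx Hy.
by exists (L w); split=> //; exact: is_RInt_linear.
Qed.

Lemma filter_prod_pos :
  filter_prod (at_right 0) (Rbar_locally p_infty)
    (fun ab => 0 < fst ab /\ 0 < snd ab).
Proof.
apply: (Filter_prod _ _ _ (fun a => 0 < a) (fun b => 0 < b)) => //.
- by exists (mkposreal 1 Rlt_0_1).
- by exists 0.
Qed.

Lemma is_RInt_gen_ext_pos (W : NormedModule R_AbsRing) (f g : R -> W) (z : W) :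
  (forall t, 0 < t -> f t = g t) ->
  is_RInt_gen f (at_right 0) (Rbar_locally p_infty) z ->
  is_RInt_gen g (at_right 0) (Rbar_locally p_infty) z.
Proof.
move=> Hfg; apply: is_RInt_gen_ext.
case: filter_prod_pos => Q S HQ HS H.
apply: (Filter_prod _ _ _ _ _ HQ HS) => x y Hx Hy t /= [Ht _].
have [/= H1 H2] := H x y Hx Hy.
by apply: Hfg; apply: Rlt_trans Ht; exact: Rmin_pos.
Qed.

Lemma is_RInt_gen_inj (g : R -> R) (G G' : R) :
  is_RInt_gen g (at_right 0) (Rbar_locally p_infty) G ->
  is_RInt_gen g (at_right 0) (Rbar_locally p_infty) G' -> G = G'.
Proof.
move=> H H'; have E := is_RInt_gen_unique (V := R_CompleteNormedModule) _ _ H.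
have E' := is_RInt_gen_unique (V := R_CompleteNormedModule) _ _ H'.
by rewrite -E E'.
Qed.

(** Truncations to intervals containing [[1, 2]] come arbitrarily close to [G], and the parts
    outside [[1, 2]] contribute a non-negative amount. *)
Lemma is_RInt_gen_ge (g : R -> R) (k G : R) :
  is_RInt_gen g (at_right 0) (Rbar_locally p_infty) G ->
  (forall t, 0 < t -> 0 <= g t) -> (forall t, 1 <= t <= 2 -> k <= g t) -> k <= G.
Proof.
move=> HG Hpos Hk; apply: Rnot_lt_le => Hlt.
have HP : locally G (fun y : R => y < k) by exact: open_lt.
have [Q S [d Hd] [M HM] H] := HG _ HP.
have Hd0 := cond_pos d.
pose a := Rmin (d / 2) (1 / 2); pose b := Rmax (M + 1) 3.
have Ha0 : 0 < a by apply: Rmin_pos; lra.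
have Ha1 : a <= d / 2 by exact: Rmin_l.
have Ha2 : a <= 1 / 2 by exact: Rmin_r.
have Hb1 : M + 1 <= b by exact: Rmax_l.
have Hb2 : 3 <= b by exact: Rmax_r.
have HQ : Q a.
  apply: Hd => //; rewrite /ball /= /AbsRing_ball /abs /minus /plus /opp /=.
  by rewrite Rabs_pos_eq; lra.
have HS : S b by apply: HM; lra.
have [y [/= Hy1 Hy2]] := H a b HQ HS.
have Hex : ex_RInt g a b by exists y.
have Hyb : y = RInt g a b by rewrite (is_RInt_unique _ _ _ _ Hy1).
have Hex1 : ex_RInt g a 1 by apply: (ex_RInt_Chasles_1 _ _ _ b) => //; lra.
have Hex2 : ex_RInt g 1 b by apply: (ex_RInt_Chasles_2 _ a) => //; lra.
have Hex3 : ex_RInt g 1 2 by apply: (ex_RInt_Chasles_1 _ _ _ b) => //; lra.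
have Hex4 : ex_RInt g 2 b by apply: (ex_RInt_Chasles_2 _ 1) => //; lra.
have E1 : RInt g a 1 + RInt g 1 b = RInt g a b by exact: (RInt_Chasles g).
have E2 : RInt g 1 2 + RInt g 2 b = RInt g 1 b by exact: (RInt_Chasles g).
have H1 : 0 <= RInt g a 1.
  by apply: RInt_ge_0 => //; [lra|move=> t Ht; apply: Hpos; lra].
have H2 : 0 <= RInt g 2 b.
  by apply: RInt_ge_0 => //; [lra|move=> t Ht; apply: Hpos; lra].
have H3 : k <= RInt g 1 2.
  have -> : k = RInt (fun _ : R => k) 1 2.
    by rewrite RInt_const /scal /= /mult /=; lra.
  apply: RInt_le => //; [lra|exact: ex_RInt_const|].
  by move=> t Ht; apply: Hk; lra.
lra.
Qed.

Lemma Rpower_is_derive (p t : R) : 0 < t ->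
  is_derive (fun x => Rpower x p) t (p * Rpower t (p - 1)).
Proof. by move=> Ht; apply/is_derive_Reals; exact: derivable_pt_lim_power. Qed.

Lemma Rpower_continuous (p t : R) : 0 < t -> continuous (fun x => Rpower x p) t.
Proof.
by move=> Ht; apply: ex_derive_continuous; eexists; exact: Rpower_is_derive.
Qed.

Section ImproperIntegral.

Variable W : CompleteNormedModule R_AbsRing.
Variable f : R -> W.
Hypothesis f_cont : forall t, 0 < t -> continuous f t.

Lemma ex_RInt_pos (a b : R) : 0 < a -> 0 < b -> ex_RInt f a b.
Proof.
move=> Ha Hb; apply: ex_RInt_continuous => t [Ht _]; apply: f_cont.
by apply: Rlt_le_trans Ht; exact: Rmin_pos.
Qed.

(** The majorant is the derivative of [K * t ^ p]. The sign of [p] is left free so that one bound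
    serves both at 0, with [p > 0], and at infinity, with [p < 0] and hence [K <= 0]. *)
Lemma RInt_power_bound (K p a b : R) : 0 < a <= b -> p <> 0 ->
  (forall t, 0 < t -> norm (f t) <= K * p * Rpower t (p - 1)) ->
  norm (RInt f a b) <= K * Rpower b p - K * Rpower a p.
Proof.
move=> [Ha Hab] Hp Hf.
have Hg : is_RInt (fun t => K * (p * Rpower t (p - 1))) a b
    (K * (Rpower b p - Rpower a p)).
  apply: (is_RInt_scal (V := R_NormedModule) (fun t => p * Rpower t (p - 1))).
  apply: (is_RInt_derive (fun t => Rpower t p)) => t [Ht _];
    (have {}Ht : 0 < t by apply: Rlt_le_trans Ht; apply: Rmin_pos; lra).
  - exact: Rpower_is_derive.
  - apply: (continuous_scal_r (V := R_NormedModule) p); exact: Rpower_continuous.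
have -> : K * Rpower b p - K * Rpower a p = K * (Rpower b p - Rpower a p) by ring.
apply: (norm_RInt_le f (fun t => K * (p * Rpower t (p - 1))) a b) => //.
- by move=> t Ht; rewrite -Rmult_assoc; apply: Hf; lra.
- by apply: RInt_correct; apply: ex_RInt_pos; lra.
Qed.

(** Cauchy's criterion: the integral between two points is controlled by the [p]-th powers of these
    points, which tend to 0 along [F]. *)
Lemma RInt_lim_exists (K p : R) (F : (R -> Prop) -> Prop) : ProperFilter F ->
  p <> 0 ->
  (forall t, 0 < t -> norm (f t) <= K * p * Rpower t (p - 1)) ->
  (forall eps, 0 < eps -> F (fun t => 0 < t /\ Rpower t p < eps)) ->
  exists z, filterlim (fun b => RInt f 1 b) F (locally z).
Proof.
move=> HF Hp Hf Hlim.
apply: (proj1 (filterlim_locally_cauchy (U := W) _)) => eps.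
have HK : 0 < 2 * (Rabs K + 1) by have := Rabs_pos K; lra.
have He : 0 < eps / (2 * (Rabs K + 1)).
  by apply: Rdiv_lt_0_compat => //; exact: cond_pos.
exists (fun t => 0 < t /\ Rpower t p < eps / (2 * (Rabs K + 1))).
split; first exact: Hlim.
have Hgen u v : 0 < u <= v -> Rpower u p < eps / (2 * (Rabs K + 1)) ->
    Rpower v p < eps / (2 * (Rabs K + 1)) -> norm (RInt f u v) < eps.
  move=> Huv Hu Hv.
  apply: Rle_lt_trans (RInt_power_bound Huv Hp Hf) _.
  have Hu0 : 0 < Rpower u p by exact: exp_pos.
  have Hv0 : 0 < Rpower v p by exact: exp_pos.
  have H1 : Rabs K * Rpower u p <= Rabs K * (eps / (2 * (Rabs K + 1))).
    by apply: Rmult_le_compat_l; [exact: Rabs_pos|lra].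
  have H2 : Rabs K * Rpower v p <= Rabs K * (eps / (2 * (Rabs K + 1))).
    by apply: Rmult_le_compat_l; [exact: Rabs_pos|lra].
  have H3 : (Rabs K + 1) * (eps / (2 * (Rabs K + 1))) = eps / 2.
    by field; have := Rabs_pos K; lra.
  have H4 : K * Rpower v p <= Rabs K * Rpower v p.
    by apply: Rmult_le_compat_r; [lra|exact: Rle_abs].
  have H5 : - K * Rpower u p <= Rabs K * Rpower u p.
    by apply: Rmult_le_compat_r; [lra|rewrite -Rabs_Ropp; exact: Rle_abs].
  lra.
have Hdiff u v : 0 < u -> 0 < v -> minus (RInt f 1 v) (RInt f 1 u) = RInt f u v.
  move=> Hu Hv.
  rewrite -(RInt_Chasles f 1 u v); try by apply: ex_RInt_pos; lra.
  by rewrite /minus (plus_comm (RInt f 1 u)) -plus_assoc plus_opp_r plus_zero_r.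
move=> u v [Hu Hu'] [Hv Hv']; apply: norm_compat1.
case: (Rle_dec u v) => Huv; first by rewrite Hdiff //; exact: Hgen.
rewrite -norm_opp opp_minus Hdiff //; apply: Hgen => //; lra.
Qed.

Lemma Rpower_lt_of_ln (p t eps : R) : 0 < eps -> p * ln t < ln eps -> Rpower t p < eps.
Proof.
move=> He H; rewrite /Rpower -(exp_ln eps) //; exact: exp_increasing.
Qed.

Lemma improper_RInt_exists (C0 C1 p q : R) : 0 < p -> q < 0 ->
  (forall t, 0 < t -> norm (f t) <= C0 * Rpower t (p - 1)) ->
  (forall t, 0 < t -> norm (f t) <= C1 * Rpower t (q - 1)) ->
  exists z, is_RInt_gen f (at_right 0) (Rbar_locally p_infty) z.
Proof.
move=> Hp Hq H0 H1.
have [z0 Hz0] : exists z, filterlim (fun b => RInt f 1 b) (at_right 0) (locally z).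
  apply: (@RInt_lim_exists (C0 / p) p); first lra.
  - by move=> t Ht; have -> : C0 / p * p = C0 by [field; lra]; exact: H0.
  - move=> eps He; exists (mkposreal _ (exp_pos (ln eps / p))) => t Ht Ht0; split=> //.
    apply: Rpower_lt_of_ln => //.
    move: Ht; rewrite /ball /= /AbsRing_ball /abs /minus /plus /opp /=.
    rewrite Ropp_0 Rplus_0_r Rabs_pos_eq; last lra.
    move=> /(ln_increasing _ _ Ht0); rewrite ln_exp => /Rlt_div_r; lra.
have [z1 Hz1] : exists z,
    filterlim (fun b => RInt f 1 b) (Rbar_locally p_infty) (locally z).
  apply: (@RInt_lim_exists (C1 / q) q); first lra.
  - by move=> t Ht; have -> : C1 / q * q = C1 by [field; lra]; exact: H1.
  - move=> eps He; exists (exp (ln eps / q)) => t Ht.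
    have Ht0 := exp_pos (ln eps / q).
    split; first lra.
    apply: Rpower_lt_of_ln => //.
    move: Ht => /(ln_increasing _ _ Ht0); rewrite ln_exp => H.
    have E : ln eps = q * (ln eps / q) by field; lra.
    by rewrite E; nra.
exists (minus z1 z0).
apply: (filterlimi_lim_ext_loc (fun ab => minus (RInt f 1 (snd ab)) (RInt f 1 (fst ab)))).
  case: filter_prod_pos => Q S HQ HS H.
  apply: (Filter_prod _ _ _ _ _ HQ HS) => x y Hx Hy /=.
  have [/= Hx0 Hy0] := H x y Hx Hy.
  have -> : minus (RInt f 1 y) (RInt f 1 x) = plus (opp (RInt f 1 x)) (RInt f 1 y).
    by rewrite plus_comm.
  apply: (is_RInt_Chasles f x 1 y).
  - by apply: is_RInt_swap; apply: RInt_correct; apply: ex_RInt_pos; lra.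
  - by apply: RInt_correct; apply: ex_RInt_pos; lra.
apply: (filterlim_comp_2 (fun ab => RInt f 1 (snd ab)) (fun ab => opp (RInt f 1 (fst ab)))
  plus _ _ (filterlim_plus z1 (opp z0))).
- by apply: filterlim_comp Hz1; exact: filterlim_snd.
- apply: filterlim_comp (filterlim_opp z0).
  by apply: filterlim_comp Hz0; exact: filterlim_fst.
Qed.

End ImproperIntegral.

(** * Fractional powers *)

Section FractionalPower.

Variables (X : HilbertSpace) (A : operator X).
Hypotheses (Alin : linear_operator A) (Adense : densely_defined A)
  (Asa : self_adjoint A) (Apos : positive_definite A)
  (Aspec : exists l0 : R, 0 < l0 /\ forall l : C, spectrum A l -> l0 < Re l).

Lemma rin_is_linear (y : X) :
  is_linear (U := real_restriction X) (V := R_NormedModule) (fun v : X => rin v y).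
Proof.
apply: Build_is_linear.
- by move=> u v; exact: rin_plus_l.
- by move=> k v; exact: rin_scal_l.
- exists (norm y + 1); have Hy := norm_ge_0 y; split; first lra.
  move=> v; rewrite {1}/norm /= /abs /=.
  apply: Rle_trans (rin_cauchy_schwarz _ _) _.
  change (norm v * norm y <= (norm y + 1) * norm v).
  by have := norm_ge_0 v; nra.
Qed.

Lemma scal_is_linear (c : C) :
  is_linear (U := real_restriction X) (V := real_restriction X)
    (fun v : X => scal c v).
Proof.
apply: Build_is_linear.
- by move=> u v; exact: (scal_distr_l (V := X)).
- move=> k v; change (scal c (scal (RtoC k) v : X) = scal (RtoC k) (scal c v : X)).
  by module X.
- exists (Cmod c + 1); have Hc := Cmod_ge_0 c; split; first lra.
  move=> v; change (norm (scal c v : X) <= (Cmod c + 1) * norm (v : X)).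
  by rewrite norm_scal_C; have := norm_ge_0 (v : X); nra.
Qed.

Lemma shift_inv_plus (l : R) x y : 0 <= l ->
  shift_inv A l (plus x y) = plus (shift_inv A l x) (shift_inv A l y).
Proof.
move=> Hl; have [Hx Ex] := shift_inv_spec Alin Apos Aspec x Hl.
have [Hy Ey] := shift_inv_spec Alin Apos Aspec y Hl.
have [Hd He] := dom_A_plus Alin Hx Hy.
apply: (shift_inv_unique Alin Apos Aspec Hl) => //.
rewrite He -[RHS](f_equal2 plus Ex Ey); module X.
Qed.

Lemma shift_inv_scal (l : R) (c : C) x : 0 <= l ->
  shift_inv A l (scal c x) = scal c (shift_inv A l x).
Proof.
move=> Hl; have [Hx Ex] := shift_inv_spec Alin Apos Aspec x Hl.
have [Hd He] := dom_A_scal Alin c Hx.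
apply: (shift_inv_unique Alin Apos Aspec Hl) => //.
rewrite He -[RHS](f_equal (scal c) Ex); module X.
Qed.

Lemma shift_inv_bounds (l : R) x : 0 <= l ->
  norm (app A (shift_inv A l x)) <= norm x /\ l * norm (shift_inv A l x) <= norm x.
Proof.
move=> Hl; have [Hx Ex] := shift_inv_spec Alin Apos Aspec x Hl.
by have := shifted_norm Alin Apos Hl Hx; rewrite Ex.
Qed.

Lemma A_shift_inv (l : R) x : 0 <= l -> dom A x ->
  app A (shift_inv A l x) = shift_inv A l (app A x).
Proof.
move=> Hl Hdx; have [Hx Ex] := shift_inv_spec Alin Apos Aspec x Hl.
set z := shift_inv A l x in Hx Ex *.
have [Hd1 He1] := dom_A_scal Alin (RtoC l) Hx.
have [Hd2 He2] := dom_A_minus Alin Hdx Hd1.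
have Ez : app A z = minus x (scal (RtoC l) z) by rewrite -[X in minus X _]Ex; module X.
symmetry; apply: (shift_inv_unique Alin Apos Aspec Hl); first by rewrite Ez.
by rewrite {2}Ez He2 He1; module X.
Qed.

Lemma A_shift_inv_symmetric (l : R) x y : 0 <= l ->
  rin (app A (shift_inv A l x)) y = rin x (app A (shift_inv A l y)).
Proof.
move=> Hl; have [Hx Ex] := shift_inv_spec Alin Apos Aspec x Hl.
have [Hy Ey] := shift_inv_spec Alin Apos Aspec y Hl.
rewrite -{1}Ey -{2}Ex rin_plus_r rin_plus_l rin_scal_r rin_scal_l.
by rewrite (A_symmetric Asa Hx Hy).
Qed.

(** Resolvent identity: [z] and [w] being the solutions at [l] and [t],
    [(l + A) (z - w) = - (l - t) w], and [t * norm w <= norm x]. It yields the continuity of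
    Balakrishnan's integrand. *)
Lemma A_shift_inv_lipschitz (l t : R) x : 0 <= l -> 0 < t ->
  norm (minus (app A (shift_inv A l x)) (app A (shift_inv A t x))) <=
    norm x / t * Rabs (l - t).
Proof.
move=> Hl Ht.
have [Hx Ex] := shift_inv_spec Alin Apos Aspec x Hl.
have Ht0 : 0 <= t by lra.
have [Hy Ey] := shift_inv_spec Alin Apos Aspec x Ht0.
have [_ Hb] := shift_inv_bounds x Ht0.
set z := shift_inv A l x in Hx Ex *; set w := shift_inv A t x in Hy Ey Hb *.
have [Hd He] := dom_A_minus Alin Hx Hy.
have [H _] := shifted_norm Alin Apos Hl Hd.
rewrite He in H.
apply: Rle_trans H _.
have -> : plus (scal (RtoC l) (minus z w)) (minus (app A z) (app A w)) =
    scal (RtoC (- (l - t))) w.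
  have -> : plus (scal (RtoC l) (minus z w)) (minus (app A z) (app A w)) =
    minus (minus (plus (scal (RtoC l) z) (app A z))
                 (plus (scal (RtoC t) w) (app A w)))
          (scal (RtoC (l - t)) w) by module X.
  by rewrite Ex Ey; module X.
rewrite norm_scal_real Rabs_Ropp Rmult_comm.
apply: Rmult_le_compat_r; first exact: Rabs_pos.
by apply/Rle_div_r => //; rewrite Rmult_comm.
Qed.

Definition balakrishnan_integrand (a : R) (x : X) (l : R) : real_restriction X :=
  scal (RtoC (Rpower l (a - 1))) (app A (shift_inv A l x)).

Lemma balakrishnan_integrand_continuous (a : R) (x : X) (t : R) : 0 < t ->
  continuous (balakrishnan_integrand a x) t.
Proof.
move=> Ht.
apply: (continuous_scal (V := real_restriction X) (fun l => Rpower l (a - 1))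
  (fun l => app A (shift_inv A l x) : real_restriction X)).
  exact: Rpower_continuous.
apply/filterlim_locally => eps.
have Hc : 0 <= norm x / t.
  by apply: Rdiv_le_0_compat => //; exact: norm_ge_0.
have Hd : 0 < Rmin t (eps / (norm x / t + 1)).
  by apply: Rmin_pos => //; apply: Rdiv_lt_0_compat; [exact: cond_pos|lra].
exists (mkposreal _ Hd) => l.
rewrite /ball /= /AbsRing_ball /abs /minus /plus /opp /= => Hl.
have Hl1 := Rlt_le_trans _ _ _ Hl (Rmin_l _ _).
have Hl2 := Rlt_le_trans _ _ _ Hl (Rmin_r _ _).
have Hl0 : 0 <= l by move: Hl1 => /Rabs_def2; lra.
apply: (norm_compat1 (V := X)).
apply: Rle_lt_trans (A_shift_inv_lipschitz x Hl0 Ht) _.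
have E : (norm x / t + 1) * (eps / (norm x / t + 1)) = eps.
  by rewrite /Rdiv Rmult_comm Rmult_assoc Rinv_l ?Rmult_1_r; lra.
have Hr := Rabs_pos (l - t).
have H1 : norm x / t * Rabs (l - t) <= norm x / t * (eps / (norm x / t + 1)).
  by apply: Rmult_le_compat_l => //; apply: Rlt_le.
have : 0 < eps / (norm x / t + 1).
  by apply: Rdiv_lt_0_compat; [exact: cond_pos|lra].
lra.
Qed.

Section Exponent.

Variable a : R.
Hypothesis Ha : 0 < a < 1.

(** Near 0 the integrand is at most [norm x * t ^ (a - 1)]. At infinity [A] is moved through its
    resolvent onto [x], which is why [x] is taken in the domain, and the decay becomes
    [t ^ (a - 2)]. *)
Lemma balakrishnan_exists x : dom A x -> exists y, balakrishnan A a x y.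
Proof.
move=> Hx.
have Hpow t p : 0 < t -> Rabs (Rpower t p) = Rpower t p.
  by move=> Ht; apply: Rabs_pos_eq; apply: Rlt_le; exact: exp_pos.
have [z Hz] : exists z, is_RInt_gen (balakrishnan_integrand a x)
    (at_right 0) (Rbar_locally p_infty) z.
  apply: (@improper_RInt_exists (real_restriction X) _ _ (norm x) (norm (app A x)) a (a - 1));
    try lra.
  - by move=> t; exact: balakrishnan_integrand_continuous.
  - move=> t Ht; have Ht0 : 0 <= t by lra.
    change (norm (scal (RtoC (Rpower t (a - 1))) (app A (shift_inv A t x)) : X) <=
      norm x * Rpower t (a - 1)).
    rewrite norm_scal_real Hpow // Rmult_comm; apply: Rmult_le_compat_r.
      by apply: Rlt_le; exact: exp_pos.
    by have [] := shift_inv_bounds x Ht0.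
  - move=> t Ht; have Ht0 : 0 <= t by lra.
    change (norm (scal (RtoC (Rpower t (a - 1))) (app A (shift_inv A t x)) : X) <=
      norm (app A x) * Rpower t (a - 1 - 1)).
    rewrite norm_scal_real Hpow // A_shift_inv //.
    have [_ H] := shift_inv_bounds (app A x) Ht0.
    have -> : Rpower t (a - 1) = Rpower t (a - 1 - 1) * t.
      by rewrite -{3}(Rpower_1 t) // -Rpower_plus; congr (Rpower _ _); ring.
    rewrite Rmult_assoc Rmult_comm; apply: Rmult_le_compat_r => //.
    by apply: Rlt_le; exact: exp_pos.
by exists (scal (RtoC (sin (a * PI) / PI)) z); split=> //; exists z.
Qed.

Lemma sin_PI_pos : 0 < sin (a * PI) / PI.
Proof.
have HPI := PI_RGT_0.
by apply: Rdiv_lt_0_compat => //; apply: sin_gt_0; nra.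
Qed.

(** Pairing with [w] replaces the vector integral by a real one, where symmetry and lower bounds can
    be read off the integrand. *)
Lemma balakrishnan_pairing x y w : balakrishnan A a x y ->
  exists r, is_RInt_gen (fun l => Rpower l (a - 1) * rin (app A (shift_inv A l x)) w)
      (at_right 0) (Rbar_locally p_infty) r /\
    rin y w = sin (a * PI) / PI * r.
Proof.
move=> [Hx [z [Hz ->]]]; exists (rin z w); split; last exact: rin_scal_l.
have := is_RInt_gen_linear (rin_is_linear w) Hz.
apply: is_RInt_gen_ext_pos => t Ht; exact: rin_scal_l.
Qed.

Lemma balakrishnan_symmetric x y x' y' :
  balakrishnan A a x y -> balakrishnan A a x' y' -> rin y x' = rin x y'.
Proof.
move=> H H'.
have [r [Hr ->]] := balakrishnan_pairing x' H.
have [r' [Hr' E]] := balakrishnan_pairing x H'.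
rewrite (rin_sym x) E; congr (_ * _).
apply: (is_RInt_gen_inj Hr).
apply: is_RInt_gen_ext_pos Hr' => t Ht.
by rewrite A_shift_inv_symmetric ?(rin_sym x'); last lra.
Qed.

(* Only the part of the integral over [1, 2] is needed for a lower bound. *)
Lemma balakrishnan_coercive : exists c, 0 < c /\
  forall x y, balakrishnan A a x y -> c * norm x <= norm y.
Proof.
have [M [HM0 HM]] := A_coercive Aspec.
(* On [[1, 2]] the weight [t ^ (a - 1)] is at least 1/2, and coercivity with [t <= 2] bounds
   [norm x] by [2 * M + 1] times [norm (app A (shift_inv A t x))]. *)
pose k := / 2 * / (2 * M + 1) ^ 2.
have Hk : 0 < k.
  apply: Rmult_lt_0_compat; first lra.
  by apply: Rinv_0_lt_compat; apply: pow_lt; lra.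
have Hs := sin_PI_pos.
exists (sin (a * PI) / PI * k); split; first exact: Rmult_lt_0_compat.
move=> x y Hxy.
have [r [Hr E]] := balakrishnan_pairing x Hxy.
(* With [z = shift_inv A t x], substituting [x = t z + A z] in the second argument gives
   [t <A z, z> + |A z|^2], whose first term is non-negative. *)
have Hform t : 0 < t -> norm (app A (shift_inv A t x)) ^ 2 <=
    rin (app A (shift_inv A t x)) x.
  move=> Ht; have Ht0 : 0 <= t by lra.
  have [Hx Ex] := shift_inv_spec Alin Apos Aspec x Ht0.
  rewrite -{3}Ex rin_plus_r rin_scal_r rin_self.
  by have := A_nonneg Alin Apos Hx; nra.
have Hlow : k * norm x ^ 2 <= r.
  apply: (is_RInt_gen_ge Hr).
  - move=> t Ht; apply: Rmult_le_pos; first by apply: Rlt_le; exact: exp_pos.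
    by apply: Rle_trans (Hform t Ht); exact: pow2_ge_0.
  - move=> t Ht; have Ht0 : 0 <= t by lra.
    have [Hx Ex] := shift_inv_spec Alin Apos Aspec x Ht0.
    have H1 : norm x <= (2 * M + 1) * norm (app A (shift_inv A t x)).
      rewrite -{1}Ex; apply: Rle_trans (norm_triangle _ _) _.
      rewrite norm_scal_real Rabs_pos_eq //.
      have H2 := HM _ Hx; have H3 := norm_ge_0 (shift_inv A t x).
      by nra.
    have Hp : / 2 <= Rpower t (a - 1).
      have Hln0 : 0 <= ln t by rewrite -ln_1; apply: ln_le; lra.
      rewrite -(exp_ln (/ 2)); last lra.
      rewrite /Rpower ln_Rinv; last lra.
      have Hln2 : ln t <= ln 2 by apply: ln_le; lra.
      have [Hlt|<-] : - ln 2 <= (a - 1) * ln t by nra.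
      + by apply: Rlt_le; exact: exp_increasing.
      + exact: Rle_refl.
    have H4 : (/ (2 * M + 1) ^ 2) * norm x ^ 2 <= rin (app A (shift_inv A t x)) x.
      apply: Rle_trans (Hform t ltac:(lra)).
      have H5 : 0 < (2 * M + 1) ^ 2 by apply: pow_lt; lra.
      apply: (Rmult_le_reg_l _ _ _ H5).
      rewrite -Rmult_assoc Rinv_r ?Rmult_1_l; last lra.
      rewrite -Rpow_mult_distr; apply: pow_incr; split=> //; exact: norm_ge_0.
    rewrite /k Rmult_assoc; apply: Rmult_le_compat => //; first lra.
    apply: Rmult_le_pos; last exact: pow2_ge_0.
    by apply: Rlt_le; apply: Rinv_0_lt_compat; apply: pow_lt; lra.
have H6 : sin (a * PI) / PI * k * norm x ^ 2 <= norm y * norm x.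
  apply: Rle_trans (rin_le y x).
  by rewrite E Rmult_assoc; apply: Rmult_le_compat_l; lra.
have Hx0 := norm_ge_0 x; have Hy0 := norm_ge_0 y.
case: (Req_dec (norm x) 0) => Hx1; first by rewrite Hx1; lra.
have Hx2 : 0 < norm x by lra.
by apply: (Rmult_le_reg_r _ _ _ Hx2); lra.
Qed.

Lemma balakrishnan_plus x y x' y' : balakrishnan A a x y -> balakrishnan A a x' y' ->
  balakrishnan A a (plus x x') (plus y y').
Proof.
move=> [Hx [z [Hz ->]]] [Hx' [z' [Hz' ->]]].
split; first by have [] := dom_A_plus Alin Hx Hx'.
exists (plus z z'); split; last by module X.
apply: (@is_RInt_gen_ext_pos (real_restriction X)
  (fun t => plus (balakrishnan_integrand a x t) (balakrishnan_integrand a x' t)));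
  last exact: (is_RInt_gen_plus (V := real_restriction X) _ _ _ _ Hz Hz').
move=> t Ht; have Ht0 : 0 <= t by lra.
change (plus (scal (RtoC (Rpower t (a - 1))) (app A (shift_inv A t x)) : X)
   (scal (RtoC (Rpower t (a - 1))) (app A (shift_inv A t x')) : X) =
   scal (RtoC (Rpower t (a - 1))) (app A (shift_inv A t (plus x x'))) :> X).
have [Hd _] := shift_inv_spec Alin Apos Aspec x Ht0.
have [Hd' _] := shift_inv_spec Alin Apos Aspec x' Ht0.
have [_ He] := dom_A_plus Alin Hd Hd'.
by rewrite shift_inv_plus // He; module X.
Qed.

Lemma balakrishnan_scal (c : C) x y : balakrishnan A a x y ->
  balakrishnan A a (scal c x) (scal c y).
Proof.
move=> [Hx [z [Hz ->]]].
split; first by have [] := dom_A_scal Alin c Hx.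
exists (scal c z); split; last by module X.
apply: (@is_RInt_gen_ext_pos (real_restriction X)
  (fun t => scal c (balakrishnan_integrand a x t : X)));
  last exact: (is_RInt_gen_linear (scal_is_linear c) Hz).
move=> t Ht; have Ht0 : 0 <= t by lra.
have [Hd _] := shift_inv_spec Alin Apos Aspec x Ht0.
have [_ He] := dom_A_scal Alin c Hd.
by rewrite /balakrishnan_integrand shift_inv_scal // He; module X.
Qed.

Notation G := (graph_closure (balakrishnan A a)).

Lemma graph_closure_incl (H : X -> X -> Prop) x y : H x y -> graph_closure H x y.
Proof.
move=> Hxy eps He; exists x, y; split=> //.
have E (z : X) : minus z z = zero by module X.
by rewrite !E norm_zero.
Qed.

Lemma graph_closure_idem (H : X -> X -> Prop) x y :
  graph_closure (graph_closure H) x y -> graph_closure H x y.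
Proof.
move=> HH eps He.
have [x1 [y1 [H1 [Hx1 Hy1]]]] := HH (eps / 2) ltac:(lra).
have [x2 [y2 [H2 [Hx2 Hy2]]]] := H1 (eps / 2) ltac:(lra).
exists x2, y2; split=> //.
have := norm_minus_triangle x2 x1 x; have := norm_minus_triangle y2 y1 y.
lra.
Qed.

Lemma frac_symmetric x y x' y' : G x y -> balakrishnan A a x' y' ->
  rin y x' = rin x y'.
Proof.
move=> HG H'.
have Hn1 := norm_ge_0 x'; have Hn2 := norm_ge_0 y'.
have Hle : Rabs (rin y x' - rin x y') <= 0.
  apply: Rnot_lt_le => Hlt.
  pose eps := Rabs (rin y x' - rin x y') / (norm x' + norm y' + 1).
  have Heps : 0 < eps by apply: Rdiv_lt_0_compat; lra.
  have [x1 [y1 [H1 [Hx1 Hy1]]]] := HG eps Heps.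
  have E : rin y x' - rin x y' = rin (minus x1 x) y' - rin (minus y1 y) x'.
    by rewrite !rin_minus_l (balakrishnan_symmetric H1 H'); ring.
  have H2 : Rabs (rin (minus x1 x) y') <= eps * norm y'.
    apply: Rle_trans (rin_cauchy_schwarz _ _) _.
    by apply: Rmult_le_compat_r => //; lra.
  have H3 : Rabs (rin (minus y1 y) x') <= eps * norm x'.
    apply: Rle_trans (rin_cauchy_schwarz _ _) _.
    by apply: Rmult_le_compat_r => //; lra.
  have H4 : eps * (norm x' + norm y' + 1) = Rabs (rin y x' - rin x y').
    by rewrite /eps; field; lra.
  have := Rabs_triang (rin (minus x1 x) y') (- rin (minus y1 y) x').
  rewrite Rabs_Ropp -/(Rminus _ _) -E; lra.
have := Rabs_pos (rin y x' - rin x y').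
move=> H0; have /Rabs_eq_0 : Rabs (rin y x' - rin x y') = 0 by lra.
lra.
Qed.

(** A symmetric densely defined operator is closable: the difference of two values at [x] is
    orthogonal to the dense domain of [A]. This gives meaning to the [iota] in
    [balakrishnan_closure]. *)
Lemma frac_unique x y y' : G x y -> G x y' -> y = y'.
Proof.
move=> H H'; apply: eq_of_norm_minus.
apply: (densely_defined_norm_le Adense); first lra.
move=> w Hw; have [v Hv] := balakrishnan_exists Hw.
rewrite rin_minus_l (frac_symmetric H Hv) (frac_symmetric H' Hv); lra.
Qed.

Lemma frac_plus x y x' y' : G x y -> G x' y' -> G (plus x x') (plus y y').
Proof.
move=> H H' eps He.
have [x1 [y1 [H1 [Hx1 Hy1]]]] := H (eps / 2) ltac:(lra).
have [x2 [y2 [H2 [Hx2 Hy2]]]] := H' (eps / 2) ltac:(lra).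
exists (plus x1 x2), (plus y1 y2); split; first exact: balakrishnan_plus.
have E (u v u' v' : X) :
    norm (minus (plus u v) (plus u' v')) <= norm (minus u u') + norm (minus v v').
  have -> : minus (plus u v) (plus u' v') = plus (minus u u') (minus v v') by module X.
  exact: norm_triangle.
split; (apply: Rle_lt_trans; first exact: E); lra.
Qed.

Lemma frac_scal (c : C) x y : G x y -> G (scal c x) (scal c y).
Proof.
move=> H eps He.
have Hc := Cmod_ge_0 c.
have He' : 0 < eps / (Cmod c + 1) by apply: Rdiv_lt_0_compat; lra.
have [x1 [y1 [H1 [Hx1 Hy1]]]] := H _ He'.
exists (scal c x1), (scal c y1); split; first exact: balakrishnan_scal.
have E (u v : X) : norm (minus u v) < eps / (Cmod c + 1) ->
    norm (minus (scal c u) (scal c v)) < eps.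
  have -> : minus (scal c u) (scal c v) = scal c (minus u v) by module X.
  rewrite norm_scal_C => Hu.
  have H2 : (Cmod c + 1) * (eps / (Cmod c + 1)) = eps by field; lra.
  by have := norm_ge_0 (minus u v); nra.
by split; exact: E.
Qed.

Lemma frac_coercive : exists c, 0 < c /\ forall x y, G x y -> c * norm x <= norm y.
Proof.
have [c [Hc H]] := balakrishnan_coercive.
exists c; split=> // x y HG; apply: Rnot_lt_le => Hlt.
pose eps := (c * norm x - norm y) / (c + 1).
have Heps : 0 < eps by apply: Rdiv_lt_0_compat; lra.
have E : eps * (c + 1) = c * norm x - norm y by rewrite /eps; field; lra.
have [x1 [y1 [H1 [Hx1 Hy1]]]] := HG eps Heps.
have H2 := H _ _ H1.
have H3 := norm_le_minus_plus x x1; rewrite norm_minus_sym in H3.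
have H4 := norm_le_minus_plus y1 y.
have H5 : c * norm x <= c * (norm (minus x1 x) + norm x1) by apply: Rmult_le_compat_l; lra.
have H6 : c * norm (minus x1 x) <= c * eps by apply: Rmult_le_compat_l; lra.
lra.
Qed.

Lemma frac_graph x y : graph (balakrishnan_closure A a) x y <-> G x y.
Proof.
split.
- move=> [[y' Hy'] <-]; rewrite /=.
  apply: (iota_correct (G x)); exists y'; split=> // y'' Hy''.
  exact: frac_unique Hy' Hy''.
- move=> H; split; first by exists y.
  apply: (iota_unique (G x)) => // y' Hy'; exact: frac_unique Hy' H.
Qed.

End Exponent.

(** Collects what is required of each factor of the phase space, whose exponents stay below 1; the
    exponent 1 occurs only in the domain of [Lambda], where the power is [A] itself. *)
Lemma frac_pow_closed_linear (a : R) : 0 <= a < 1 ->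
  (forall x, dom A x -> dom (frac_pow A a) x) /\
  (forall x y u v, graph (frac_pow A a) x u -> graph (frac_pow A a) y v ->
     graph (frac_pow A a) (plus x y) (plus u v)) /\
  (forall (c : C) x u, graph (frac_pow A a) x u ->
     graph (frac_pow A a) (scal c x) (scal c u)) /\
  closed_operator (frac_pow A a) /\
  exists c, 0 < c /\ forall x u, graph (frac_pow A a) x u -> c * norm x <= norm u.
Proof.
move=> [Ha0 Ha1]; rewrite /frac_pow.
case: Req_EM_T => Ha.
  split=> //; split; first by move=> x y u v [_ <-] [_ <-].
  split; first by move=> c x u [_ <-].
  split.
    move=> x y H; split=> //=; apply: eq_of_norm_minus.
    apply: Rnot_lt_le => Hlt.
    have [x1 [y1 [[_ <-] [/= Hx1 Hy1]]]] := H (norm (minus x y) / 2) ltac:(lra).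
    have := norm_minus_triangle x x1 y; rewrite (norm_minus_sym x x1); lra.
  by exists 1; split; [lra|move=> x u [_ <-]; rewrite Rmult_1_l; exact: Rle_refl].
case: Req_EM_T => Ha'; first lra.
have Ha2 : 0 < a < 1 by lra.
have HG x y := frac_graph Ha2 x y.
split.
  move=> x Hx; have [y Hy] := balakrishnan_exists Ha2 Hx.
  by exists y; exact: graph_closure_incl.
split; first by move=> x y u v /HG Hx /HG Hy; apply/HG; exact: frac_plus.
split; first by move=> c x u /HG Hx; apply/HG; exact: frac_scal.
split.
  move=> x y H; apply/HG; apply: graph_closure_idem => eps He.
  have [x1 [y1 [/HG H1 H2]]] := H eps He.
  by exists x1, y1.
have [c [Hc H]] := frac_coercive Ha2.
by exists c; split=> // x u /HG; exact: H.
Qed.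

End FractionalPower.

(** * The phase space *)

Lemma big_sq_ge0 (I : Type) (r : list I) (f : I -> R) :
  0 <= \big[Rplus/0]_(i <- r) (f i) ^ 2.
Proof.
elim: r => [|i r IH]; first by rewrite big_nil; lra.
by rewrite big_cons; have := pow2_ge_0 (f i); lra.
Qed.

Lemma big_sq_ge_term (I : eqType) (r : seq I) (f : I -> R) (j : I) :
  j \in r -> (f j) ^ 2 <= \big[Rplus/0]_(i <- r) (f i) ^ 2.
Proof.
elim: r => [//|i r IH]; rewrite in_cons big_cons => /orP [/eqP ->|/IH H].
- by have := big_sq_ge0 r f; lra.
- by have := pow2_ge_0 (f i); lra.
Qed.

Lemma big_sq_le (I : Type) (r : list I) (f : I -> R) (c : R) :
  (forall i, 0 <= f i <= c) ->
  \big[Rplus/0]_(i <- r) (f i) ^ 2 <= INR (size r) * c ^ 2.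
Proof.
move=> H; elim: r => [|i r IH]; first by rewrite big_nil /=; lra.
rewrite big_cons [size _]/= S_INR.
have H1 : f i ^ 2 <= c ^ 2 by apply: pow_incr; exact: H.
lra.
Qed.

Lemma big_sq_scale (I : Type) (r : list I) (f : I -> R) (c : R) :
  \big[Rplus/0]_(i <- r) (c * f i) ^ 2 = c ^ 2 * \big[Rplus/0]_(i <- r) (f i) ^ 2.
Proof.
elim: r => [|i r IH]; first by rewrite !big_nil; ring.
by rewrite !big_cons IH; ring.
Qed.

Lemma big_sq_minkowski (I : Type) (r : list I) (f g h : I -> R) :
  (forall i, 0 <= f i) -> (forall i, 0 <= g i) -> (forall i, 0 <= h i <= f i + g i) ->
  sqrt (\big[Rplus/0]_(i <- r) (h i) ^ 2) <=
    sqrt (\big[Rplus/0]_(i <- r) (f i) ^ 2) + sqrt (\big[Rplus/0]_(i <- r) (g i) ^ 2).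
Proof.
move=> Hf Hg Hh; elim: r => [|i r IH]; first by rewrite !big_nil sqrt_0; lra.
rewrite !big_cons.
set F := \big[_/_]_(_ <- _) (f _) ^ 2 in IH *.
set G := \big[_/_]_(_ <- _) (g _) ^ 2 in IH *.
set H := \big[_/_]_(_ <- _) (h _) ^ 2 in IH *.
have HF : 0 <= F by exact: big_sq_ge0.
have HG : 0 <= G by exact: big_sq_ge0.
have HH : 0 <= H by exact: big_sq_ge0.
have {}Hf := Hf i; have {}Hg := Hg i; have [Hh0 Hh1] := Hh i.
have HF2 := pow2_sqrt _ HF; have HG2 := pow2_sqrt _ HG; have HH2 := pow2_sqrt _ HH.
move: (sqrt_pos F) (sqrt_pos G) (sqrt_pos H) => Fp Gp Hp.
have Hf2 := pow2_ge_0 (f i); have Hg2 := pow2_ge_0 (g i); have Hh2 := pow2_ge_0 (h i).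
have HS1 : 0 <= f i ^ 2 + F by lra.
have HS2 : 0 <= g i ^ 2 + G by lra.
have HS3 : 0 <= h i ^ 2 + H by lra.
have E1 := pow2_sqrt _ HS1; have E2 := pow2_sqrt _ HS2.
have P1 := sqrt_pos (f i ^ 2 + F); have P2 := sqrt_pos (g i ^ 2 + G).
apply: le_of_sq_le; first lra.
rewrite (pow2_sqrt _ HS3).
(* Cauchy-Schwarz in the plane; the squares of the two sides differ by
   [(f i * sqrt G - g i * sqrt F) ^ 2]. *)
have Hcs : f i * g i + sqrt F * sqrt G <= sqrt (f i ^ 2 + F) * sqrt (g i ^ 2 + G).
  apply: le_of_sq_le; first exact: Rmult_le_pos.
  rewrite Rpow_mult_distr E1 E2 -{2}HF2 -{2}HG2.
  by have := pow2_ge_0 (f i * sqrt G - g i * sqrt F); lra.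
have H1 : h i ^ 2 <= (f i + g i) ^ 2 by apply: pow_incr.
have H2 : H <= (sqrt F + sqrt G) ^ 2 by rewrite -HH2; apply: pow_incr.
lra.
Qed.

Lemma big_sq_cvg0 (I : Type) (r : list I) (f : I -> nat -> R) :
  (forall i k, 0 <= f i k) ->
  (forall i eps, 0 < eps -> exists N : nat, forall k : nat,
     (N <= k)%coq_nat -> f i k < eps) ->
  forall eps, 0 < eps -> exists N : nat, forall k : nat,
    (N <= k)%coq_nat -> \big[Rplus/0]_(i <- r) (f i k) ^ 2 < eps.
Proof.
move=> Hf0 Hf; elim: r => [|i r IH] eps Heps.
  by exists O => k _; rewrite big_nil.
have [N1 H1] := IH (eps / 2) ltac:(lra).
have Hs : 0 < sqrt (eps / 2) by apply: sqrt_lt_R0; lra.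
have [N2 H2] := Hf i _ Hs.
exists (Nat.max N1 N2) => k Hk; rewrite big_cons.
have {}H1 := H1 k ltac:(lia); have {}H2 := H2 k ltac:(lia).
have H3 : sqrt (eps / 2) ^ 2 = eps / 2 by apply: pow2_sqrt; lra.
have := Hf0 i k; nra.
Qed.

Lemma norm_cauchy_cvg (X : CompleteNormedModule C_AbsRing) (u : nat -> X) :
  (forall eps, 0 < eps -> exists N : nat, forall k m : nat,
     (N <= k)%coq_nat -> (N <= m)%coq_nat -> norm (minus (u k) (u m)) < eps) ->
  exists x, forall eps, 0 < eps -> exists N : nat, forall k : nat,
    (N <= k)%coq_nat -> norm (minus (u k) x) < eps.
Proof.
move=> Hu.
have [x Hx] : exists x, filterlim u eventually (locally x).
  apply: (proj1 (filterlim_locally_cauchy (U := X) _)) => eps.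
  have [N HN] := Hu eps (cond_pos eps).
  exists (fun k => (N <= k)%coq_nat); split; first by exists N.
  by move=> k m Hk Hm; apply: norm_compat1; exact: HN.
exists x => eps Heps.
have := proj1 (filterlim_locally_ball_norm u x) Hx (mkposreal eps Heps).
by case=> N HN; exists N.
Qed.

Lemma Cpow_polar (r t : R) (k : nat) :
  Cpow (r * cos t, r * sin t) k = (r ^ k * cos (INR k * t), r ^ k * sin (INR k * t)).
Proof.
elim: k => [|k IH].
  by rewrite /= Rmult_0_l cos_0 sin_0; apply: injective_projections => /=; ring.
rewrite S_INR Rmult_plus_distr_r Rmult_1_l cos_plus sin_plus /= IH.
by apply: injective_projections => /=; ring.
Qed.

(* For [n >= 3] the root of [-mu] with argument [PI / n] lies in the open right
   half-plane, and its real part tends to infinity with [mu]. *)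
Lemma root_large_real_part (n : nat) (om : R) : (3 <= n)%N ->
  exists m, forall mu, m <= mu -> 0 < mu ->
    exists l : C, om <= Re l /\ Cpow l n = RtoC (- mu).
Proof.
move=> /leP Hn.
have Hn3 : 3 <= INR n by have := le_INR _ _ Hn; rewrite /=; lra.
have HPI := PI_RGT_0.
have Hdiv : PI / INR n < PI / 2.
  by apply: Rmult_lt_compat_l => //; apply: Rinv_lt_contravar; lra.
have Hcos : 0 < cos (PI / INR n).
  apply: cos_gt_0 => //.
  have : 0 < PI / INR n by apply: Rdiv_lt_0_compat; lra.
  lra.
(* The modulus from which [r * cos (PI / INR n)] reaches [om]; the maximum with 0 keeps it
   non-negative, so that powers are monotone. *)
pose r0 := Rmax om 0 / cos (PI / INR n).
have Hr0 : 0 <= r0 by apply: Rdiv_le_0_compat => //; exact: Rmax_r.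
exists (r0 ^ n + 1) => mu Hmu Hmu0.
pose r := Rpower mu (/ INR n).
have Hr : 0 < r by exact: exp_pos.
have Hrn : r ^ n = mu.
  rewrite -Rpower_pow // /r Rpower_mult Rinv_l ?Rpower_1 //; lra.
have Hrr0 : r0 <= r.
  apply: Rnot_lt_le => Hlt.
  have : r ^ n <= r0 ^ n by apply: pow_incr; lra.
  lra.
exists (r * cos (PI / INR n), r * sin (PI / INR n)); split.
  rewrite /=; apply: Rle_trans (Rmax_l om 0) _.
  by apply/Rle_div_l.
rewrite Cpow_polar Hrn.
have -> : INR n * (PI / INR n) = PI by field; lra.
by rewrite cos_PI sin_PI; apply: injective_projections => /=; ring.
Qed.

Lemma frac_pow_0 (X : CompleteNormedModule C_AbsRing) (A : operator X) :
  frac_pow A 0 = Operator (fun _ => True) (fun x => x).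
Proof. by rewrite /frac_pow; destruct (Req_EM_T 0 0). Qed.

Lemma frac_pow_1 (X : CompleteNormedModule C_AbsRing) (A : operator X) :
  frac_pow A 1 = A.
Proof.
rewrite /frac_pow; destruct (Req_EM_T 1 0); first lra.
by destruct (Req_EM_T 1 1).
Qed.

Section PhaseSpace.

Variables (X : HilbertSpace) (A : operator X).
Hypotheses (Alin : linear_operator A) (Adense : densely_defined A)
  (Asa : self_adjoint A) (Apos : positive_definite A)
  (Aspec : exists l0 : R, 0 < l0 /\ forall l : C, spectrum A l -> l0 < Re l).
Variable n : nat.

Lemma exponent_range (i : 'I_n) : 0 <= INR (n - i.+1)%N / INR n < 1.
Proof.
have Hi : (i.+1 <= n)%coq_nat by apply/leP.
have Hlt : ((n - i.+1)%N < n)%coq_nat by rewrite /subn /subn_rec; lia.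
have Hn : 0 < INR n by apply: lt_0_INR; lia.
split; first by apply: Rdiv_le_0_compat => //; exact: pos_INR.
by apply/Rlt_div_l => //; rewrite Rmult_1_l; exact: lt_INR.
Qed.

Notation P i := (frac_pow A (INR (n - (nat_of_ord i).+1)%N / INR n)).
Notation Y := (phase_space A n).

Lemma component_facts (i : 'I_n) :
  (forall x, dom A x -> dom (P i) x) /\
  (forall x y u v, graph (P i) x u -> graph (P i) y v ->
     graph (P i) (plus x y) (plus u v)) /\
  (forall (c : C) x u, graph (P i) x u -> graph (P i) (scal c x) (scal c u)) /\
  closed_operator (P i) /\
  exists c, 0 < c /\ forall x u, graph (P i) x u -> c * norm x <= norm u.
Proof. exact: (frac_pow_closed_linear Alin Adense Asa Apos Aspec (exponent_range i)). Qed.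

Lemma component_plus (i : 'I_n) x y : dom (P i) x -> dom (P i) y ->
  dom (P i) (plus x y) /\ app (P i) (plus x y) = plus (app (P i) x) (app (P i) y).
Proof. by move=> Hx Hy; have [_ [H _]] := component_facts i; exact: H. Qed.

Lemma component_scal (i : 'I_n) (c : C) x : dom (P i) x ->
  dom (P i) (scal c x) /\ app (P i) (scal c x) = scal c (app (P i) x).
Proof. by move=> Hx; have [_ [_ [H _]]] := component_facts i; exact: H. Qed.

Lemma component_minus (i : 'I_n) x y : dom (P i) x -> dom (P i) y ->
  dom (P i) (minus x y) /\ app (P i) (minus x y) = minus (app (P i) x) (app (P i) y).
Proof.
move=> Hx Hy; have [Hd He] := component_scal (RtoC (-1)) Hy.
have [Hd' He'] := component_plus Hx Hd.
have -> : minus x y = plus x (scal (RtoC (-1)) y) by module X.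
by split=> //; rewrite He' He; module X.
Qed.

Lemma component_zero (i : 'I_n) :
  dom (P i) (zero : X) /\ app (P i) (zero : X) = zero.
Proof.
have Hd : dom (P i) (zero : X) by apply: (proj1 (component_facts i)); exact: (proj1 Alin).
split=> //; have [_ He] := component_minus Hd Hd.
have E (z : X) : minus z z = zero by module X.
by rewrite !E in He.
Qed.

Lemma phase_space_component_le (v : 'I_n -> X) (i : 'I_n) :
  norm (app (P i) (v i)) <= nrm Y v.
Proof.
apply: le_of_sq_le; first exact: sqrt_pos.
rewrite pow2_sqrt; last exact: big_sq_ge0.
exact: (@big_sq_ge_term _ (index_enum 'I_n)
  (fun i : 'I_n => frac_norm A (INR (n - i.+1)%N / INR n) (v i)) i (mem_index_enum i)).
Qed.

(** A crude bound, with [n] in place of its square root; the factor is absorbed by the accuracy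
    demanded of the approximate eigenvector. *)
Lemma phase_space_le (v : 'I_n -> X) (c : R) :
  (forall i, norm (app (P i) (v i)) <= c) -> 0 <= c -> nrm Y v <= INR n * c.
Proof.
move=> H Hc; apply: le_of_sq_le; first by apply: Rmult_le_pos => //; exact: pos_INR.
rewrite pow2_sqrt; last exact: big_sq_ge0.
have Hle := @big_sq_le _ (index_enum 'I_n)
  (fun i : 'I_n => frac_norm A (INR (n - i.+1)%N / INR n) (v i)) c
  (fun i => conj (norm_ge_0 _) (H i)).
apply: Rle_trans Hle _.
have -> : size (index_enum 'I_n) = n by rewrite [index_enum _]unlock -enumT size_enum_ord.
rewrite Rpow_mult_distr; apply: Rmult_le_compat_r; first exact: pow2_ge_0.
case: (n) => [|k]; first by rewrite /=; lra.
by rewrite S_INR; have := pos_INR k; nra.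
Qed.

Lemma phase_space_seminorm : is_seminorm Y.
Proof.
split.
- by move=> i; case: (component_zero i).
- by move=> u v Hu Hv i; case: (component_plus (Hu i) (Hv i)).
- by move=> c v Hv i; case: (component_scal c (Hv i)).
- move=> u v Hu Hv; apply: big_sq_minkowski; try by move=> i; exact: norm_ge_0.
  move=> i; split; first exact: norm_ge_0.
  rewrite /frac_norm.
  have [_ He] := component_plus (Hu i) (Hv i).
  by rewrite [plus u v i]/= He; exact: norm_triangle.
- move=> c v Hv; have Hc := Cmod_ge_0 c.
  rewrite /= -(sqrt_pow2 _ Hc) -sqrt_mult; try exact: pow2_ge_0; last exact: big_sq_ge0.
  congr (sqrt _); rewrite -big_sq_scale; apply: eq_bigr => i _.
  rewrite /frac_norm; have [_ ->] := component_scal c (Hv i).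
  by rewrite norm_scal_C.
Qed.

(** In each component the images under the fractional power are Cauchy, hence converge; since the
    power is bounded below, the components converge too, and closedness identifies the limit of the
    images. *)
Lemma phase_space_complete : is_complete Y.
Proof.
move=> u Hu Hcauchy.
have Hmin k m i : app (P i) (minus (u k) (u m) i) =
    minus (app (P i) (u k i)) (app (P i) (u m i)).
  by have [_ H] := component_minus (Hu k i) (Hu m i).
have Hlim i : exists x, dom (P i) x /\ forall eps, 0 < eps ->
    exists N : nat, forall k : nat, (N <= k)%coq_nat ->
      norm (app (P i) (minus (u k i) x)) < eps.
  have [_ [_ [_ [Hcl [c [Hc Hcoer]]]]]] := component_facts i.
  have [y Hy] : exists y, forall eps, 0 < eps -> exists N : nat, forall k : nat,
      (N <= k)%coq_nat -> norm (minus (app (P i) (u k i)) y) < eps.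
    apply: norm_cauchy_cvg => eps Heps; have [N HN] := Hcauchy eps Heps.
    exists N => k m Hk Hm; rewrite -Hmin.
    exact: Rle_lt_trans (phase_space_component_le _ i) (HN k m Hk Hm).
  have [x Hx] : exists x, forall eps, 0 < eps -> exists N : nat, forall k : nat,
      (N <= k)%coq_nat -> norm (minus (u k i) x) < eps.
    apply: norm_cauchy_cvg => eps Heps.
    have [N HN] := Hcauchy (c * eps) ltac:(nra).
    exists N => k m Hk Hm.
    have [Hd He] := component_minus (Hu k i) (Hu m i).
    have H1 : c * norm (minus (u k i) (u m i)) <= norm (app (P i) (minus (u k i) (u m i))).
      exact: Hcoer.
    have H2 := Rle_lt_trans _ _ _ (phase_space_component_le _ i) (HN k m Hk Hm).
    by apply: (Rmult_lt_reg_l _ _ _ Hc); exact: Rle_lt_trans H1 H2.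
  have [Hdx Hax] : graph (P i) x y.
    apply: Hcl => eps Heps.
    have [N1 H1] := Hx eps Heps; have [N2 H2] := Hy eps Heps.
    exists (u (Nat.max N1 N2) i), (app (P i) (u (Nat.max N1 N2) i)).
    by split; [split=> //; exact: Hu|split; [apply: H1|apply: H2]; lia].
  exists x; split=> // eps Heps; have [N HN] := Hy eps Heps.
  exists N => k Hk; have [_ He] := component_minus (Hu k i) Hdx.
  by rewrite He Hax; exact: HN.
pose x i := proj1_sig (constructive_indefinite_description _ (Hlim i)).
have Hx i : dom (P i) (x i) /\ forall eps, 0 < eps ->
    exists N : nat, forall k : nat, (N <= k)%coq_nat ->
      norm (app (P i) (minus (u k i) (x i))) < eps.
  exact: (proj2_sig (constructive_indefinite_description _ (Hlim i))).
exists x; split; first by move=> i; case: (Hx i).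
move=> eps Heps.
have [N HN] := @big_sq_cvg0 _ (index_enum 'I_n)
  (fun i k => norm (app (P i) (minus (u k i) (x i))))
  (fun i k => norm_ge_0 _) (fun i => proj2 (Hx i)) (eps ^ 2) (pow_lt _ 2 Heps).
exists N => k Hk; rewrite -(sqrt_pow2 eps); last lra.
apply: sqrt_lt_1; [exact: big_sq_ge0|exact: pow2_ge_0|exact: HN].
Qed.

End PhaseSpace.

Theorem theorem1p1 :
  forall (X : HilbertSpace) (A : operator X),
    separable X ->
    linear_operator A ->
    ~ bounded_operator A ->
    closed_operator A ->
    densely_defined A ->
    self_adjoint A ->
    positive_definite A ->
    (exists l0 : R, 0 < l0 /\ forall l : C, spectrum A l -> l0 < Re l) ->
    forall n : nat, (3 <= n)%N ->
      ~ generates_C0_semigroup (phase_space A n) (opp_op (Lambda A n)).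
Proof.
move=> X A _ Alin Aunb _ Adense Asa Apos Aspec n Hn [T [HT HG]].
have HY := phase_space_seminorm Alin Adense Asa Apos Aspec n.
have HYc : is_complete (phase_space A n).
  exact: (phase_space_complete Alin Adense Asa Apos Aspec).
have [K [om [HK Hres]]] := C0_semigroup_resolvent_bound HY HYc HT.
(* The maximum with 1 forces [Cmod l >= 1], so that the last component [l ^ (n - 1) x] is at least
   as long as [x]. *)
have [m Hm] := root_large_real_part (Rmax om 1) Hn.
have Hn0 : 0 < INR n by apply: lt_0_INR; apply/leP; exact: leq_trans Hn.
have HKn : 0 < K * INR n by exact: Rmult_lt_0_compat.
(* With this accuracy the resolvent bound, including the factor [n] of [phase_space_le], gives
   [norm x <= norm x / 2]. *)
have Heta : 0 < / (2 * (K * INR n)) by apply: Rinv_0_lt_compat; lra.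
have [mu [x [Hmu [Hmu0 [Hx [Hx0 Hax]]]]]] :=
  approximate_large_eigenvalue Alin Adense Asa Apos Aspec Aunb m Heta.
have [l [Hl Hln]] := Hm mu Hmu Hmu0.
have Hl1 : 1 <= Cmod l.
  apply: Rle_trans (re_le_Cmod l); apply: Rle_trans (Rle_abs _).
  exact: Rle_trans (Rmax_r om 1) Hl.
pose v := (fun i : 'I_n => scal (Cpow l i) x) : 'I_n -> X.
have Hv : dom (Lambda A n) v.
  move=> i; rewrite /v.
  (* The component 0 has exponent 1, outside the range of [frac_pow_closed_linear]. *)
  case: (posnP i) => Hi.
    rewrite Hi subn0 Rdiv_diag ?frac_pow_1; last lra.
    by have [] := dom_A_scal Alin (Cpow l 0) Hx.
  have Hr : 0 <= INR (n - i)%N / INR n < 1.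
    split; first by apply: Rdiv_le_0_compat => //; exact: pos_INR.
    apply/Rlt_div_l => //; rewrite Rmult_1_l; apply: lt_INR; apply/ltP.
    by rewrite ltn_subrL Hi /=; exact: leq_trans Hn.
  have [H1 [_ [H2 _]]] := frac_pow_closed_linear Alin Adense Asa Apos Aspec Hr.
  by have [] := H2 (Cpow l i) x _ (conj (H1 x Hx) erefl).
have [Hcv [Hcw Hlim]] := proj2 (HG v _) (conj Hv erefl).
have {Hres} Hres := Hres l v _ Hcv Hcw Hlim (Rle_trans _ _ _ (Rmax_l om 1) Hl).
set w := app _ v in Hcw Hlim Hres.
have Hlast : (n.-1 < n)%N by rewrite prednK //; exact: leq_trans Hn.
pose j := Ordinal Hlast.
have Hjn : j.+1 = n by rewrite /= prednK //; exact: leq_trans Hn.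
have Hlow : norm x <= nrm (phase_space A n) v.
  have := phase_space_component_le A v j.
  rewrite Hjn subnn [INR 0 / _]Rmult_0_l frac_pow_0.
  rewrite /= /v norm_scal_C Cmod_pow => H; apply: Rle_trans H.
  have := pow_R1_Rle _ j Hl1; nra.
have Hup : nrm (phase_space A n) (minus w (scal l v)) <=
    INR n * (/ (2 * (K * INR n)) * norm x).
  apply: phase_space_le => //; last by apply: Rmult_le_pos; lra.
  move=> i.
  have Ei : minus w (scal l v) i =
    minus (opp (if (i.+1 < n)%N then opp (v (ordS i)) else app A (v (ordS i))))
          (scal l (v i)) by [].
  (* As [v] is geometric, all components but the last vanish exactly. In the last one [ordS] wraps
     around to [x], and [l ^ n = - mu] leaves [- (A x - mu x)], measured with exponent 0. *)
  case: (ltnP i.+1 n) => Hi.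
    have -> : minus w (scal l v) i = zero.
      rewrite Ei Hi /v.
      have -> : nat_of_ord (ordS i) = i.+1 by rewrite /= modn_small.
      by module X.
    have [_ ->] := component_zero Alin Adense Asa Apos Aspec i.
    by rewrite norm_zero; apply: Rmult_le_pos; lra.
  have Hin : i.+1 = n by apply/eqP; rewrite eqn_leq Hi andbT.
  rewrite Hin subnn [INR 0 / _]Rmult_0_l frac_pow_0.
  have -> : minus w (scal l v) i = scal (RtoC (-1)) (minus (app A x) (scal (RtoC mu) x)).
    rewrite Ei ltnNge Hi /v.
    have -> : nat_of_ord (ordS i) = O by rewrite /= Hin modnn.
    have -> : scal (Cpow l 0) x = x by exact: (scal_one (K := C_Ring)).
    have -> : scal l (scal (Cpow l i) x) = scal (Cpow l i.+1) x by module X.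
    by rewrite Hin Hln; module X.
  by rewrite norm_scal_real Rabs_left; lra.
have H3 : K * nrm (phase_space A n) (minus w (scal l v)) <=
    K * (INR n * (/ (2 * (K * INR n)) * norm x)) by apply: Rmult_le_compat_l; lra.
have E : K * (INR n * (/ (2 * (K * INR n)) * norm x)) = norm x / 2.
  by field; lra.
by have := Rle_trans _ _ _ Hlow (Rle_trans _ _ _ Hres H3); rewrite E; lra.
Qed.
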